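(* Let $\Omega\subset\mathbb{C}^2$ be a domain of finite type with defining function $\rho$ and maximal type $m\ge 2$, such that $(1,0)\in\partial\Omega$, the normal direction to $\partial\Omega$ at $(1,0)$ is $\langle 1,0\rangle$, and $\frac{\partial\rho}{\partial z_1}$ and $\frac{\partial\rho}{\partial\overline{z}_1}$ do not vanish at $(1,0)$. Let $\mathscr{A}\subset\Omega$ be a region comparable with the admissible approach region $\mathscr{A}_1(1,0)$ and lying inside the region bounded by $|(z_1,z_2)-(1,0)|^m=|z_1-1|$ (i.e. $|(z_1,z_2)-(1,0)|^m<|z_1-1|$ on $\mathscr{A}$). Suppose $f$ is a bounded holomorphic function on $\Omega$ such that $|f(z)|\le 1$ for any $z\in\Omega$, and that for some $\ell\in\mathbb{C}$ $$\lim_{t\to1^-}f(\varphi(t))=\ell$$ for any boundary curve $\varphi:[0,1]\to\partial\Omega$ with $\varphi(1)=(1,0)$. Then $$\lim_{\mathscr{A}\ni z\to(1,0)}|f(z)-f(1,0)|=0,$$ where $f(1,0)=\ell$; that is, $f$ has admissible limit $\ell$ at $(1,0)$.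
   Context: Setting. $\Omega=\{\rho<0\}\subset\mathbb{C}^2$ with $\rho$ a $C^\infty$ defining function ($d\rho\neq 0$ on $\partial\Omega$). $\pi$ is the Euclidean normal projection onto $\partial\Omega$ (defined for points near $\partial\Omega$) and $\delta(z)=|z-\pi(z)|$ is the distance of $z$ to $\partial\Omega$. Boundary values. A boundary curve is a continuous map $\varphi:[0,1]\to\partial\Omega$. For $P\in\partial\Omega$, $|f(P)|$ is defined as $\limsup_{\Omega\ni z\to P}|f(z)|$; the boundary values $f(P)$ themselves are defined through nontangential limits, and the hypothesis on boundary curves includes that these values $f(\varphi(t))$ are defined for the curves near $(1,0)$. The value $f(1,0)$ is $\ell$. Commutators and type. Near a boundary point put $L=-\frac{\partial\rho}{\partial z_2}\frac{\partial}{\partial z_1}+\frac{\partial\rho}{\partial z_1}\frac{\partial}{\partial z_2}$, with conjugate $\overline{L}$, and let $X$ be a smooth transverse vector field such that $L,\overline{L},X$ span the (complexified) tangent space to $\partial\Omega$ at each point of the neighborhood. The fields $L,\overline{L}$ are iterated commutators of degree $1$; an iterated commutator of degree $k$ is a bracket of $L$ or $\overline{L}$ with an iterated commutator of degree $k-1$. Let $\mathscr{M}_k$ be the collection of iterated commutators of degree at most $k$; for $\mathscr{L}\in\mathscr{M}_k$ write $\mathscr{L}\equiv\lambda_{\mathscr{L}}X \bmod (L,\overline{L})$, and set $\Lambda_k=\big(\sum_{\mathscr{L}\in\mathscr{M}_k}|\lambda_{\mathscr{L}}|^2\big)^{1/2}$. The type of a boundary point $q$ is the least $k\ge 2$ with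 $\Lambda_k(q)\neq 0$ (equivalently in $\mathbb{C}^2$, the order of contact of complex curves with $\partial\Omega$ at $q$); $\Omega$ is of finite type if every boundary point has finite type and the types are bounded, and $m$ is the maximal type. Admissible regions. Set $D(z)=\inf_{2\le k\le m}\big(\delta(z)/\Lambda_k(\pi(z))\big)^{1/k}$ (a term with $\Lambda_k(\pi(z))=0$ is $+\infty$), and $\Lambda^{s}(q)=\sum_{k=2}^{m}\Lambda_k(q)s^k$ for $q\in\partial\Omega$, $s>0$. A polarization of $\rho$ is a $C^\infty$ complex-valued function $R(z,w)$ with $R(z,z)=\rho(z)$ and such that $\overline{\partial}_zR(z,w)$ and $R(z,w)-\overline{R(w,z)}$ vanish to infinite order on $z=w$; fix one. For $\alpha>0$ the admissible approach region $\mathscr{A}_\alpha(1,0)$ is the set of $z\in\Omega$ (near $(1,0)$) with $|\pi(z)-(1,0)|<\alpha D(z)$ and $|R(\pi(z),(1,0))|<\Lambda^{\alpha D(z)}(1,0)$. Comparability. A region $\mathscr{A}\subset\Omega$ is comparable with $\mathscr{A}_1(1,0)$ if there are constants $0<c\le C$ and a neighborhood $U$ of $(1,0)$ with $\mathscr{A}_c(1,0)\cap U\subset\mathscr{A}\cap U\subset\mathscr{A}_C(1,0)\cap U$. *)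

(* Defs.v *)
From HB Require Import structures.
From mathcomp Require Import all_boot all_order all_algebra.
From mathcomp Require Import complex.
From mathcomp Require Import all_classical all_reals all_analysis.
Set Implicit Arguments.
Unset Strict Implicit.
Unset Printing Implicit Defensive.
Import Order.TTheory GRing.Theory Num.Theory.
Import numFieldNormedType.Exports.
Local Open Scope classical_set_scope.
Local Open Scope ring_scope.
Local Open Scope complex_scope.

(* The regular module R[i]^o carries the normed-space structure over the
   field R[i], so that [differentiable] means complex differentiability. *)
Notation Cc R := (R[i]^o).
Notation C2 R := (R[i]^o * R[i]^o)%type.

(* Modulus and Euclidean norm with values in R; the library norms of R[i] and
   of a product take values in R[i] and are, for products, sup norms. *)
Definition cmod (R : realType) (x : Cc R) : R := ComplexField.Normc.normc x.

Definition eucl_norm (R : realType) (z : C2 R) : R :=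
  Num.sqrt (cmod z.1 ^+ 2 + cmod z.2 ^+ 2).

Definition eucl_dist (R : realType) (z w : C2 R) : R := eucl_norm (z - w).

Section RealCalculus.
Variables (R : realType) (E : normedModType R[i]).
Implicit Types (v e : E) (g : E -> Cc R) (z : E).

(* Derivatives along real lines: t ranges over R. *)
Definition rderivable v g z : Prop :=
  derivable (fun t : R => complex.Re (g (z + t%:C *: v))) 0 1 /\
  derivable (fun t : R => complex.Im (g (z + t%:C *: v))) 0 1.

Definition rpd v g z : Cc R :=
  Complex (derive1 (fun t : R => complex.Re (g (z + t%:C *: v))) 0)
          (derive1 (fun t : R => complex.Im (g (z + t%:C *: v))) 0).

Definition iter_rpd (vs : seq E) g : E -> Cc R := foldr rpd g vs.

Definition smooth_on (U : set E) g : Prop :=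
  forall (vs : seq E) z, U z ->
    {for z, continuous (iter_rpd vs g)} /\
    forall v, rderivable v (iter_rpd vs g) z.

(* Wirtinger derivatives in the complex coordinate along e. *)
Definition wd e g z : Cc R := (rpd e g z - 'i * rpd ('i *: e) g z) / 2.
Definition wdbar e g z : Cc R := (rpd e g z + 'i * rpd ('i *: e) g z) / 2.

End RealCalculus.

Definition ex1 (R : realType) : C2 R := (1, 0).
Definition ex2 (R : realType) : C2 R := (0, 1).

(* A complexified vector field on C^2: the value ((a1, a2), (b1, b2)) stands
   for a1 d/dz1 + a2 d/dz2 + b1 d/dzbar1 + b2 d/dzbar2. *)
Notation vfield R := (C2 R -> C2 R * C2 R).

Section VectorFields.
Variable R : realType.
Implicit Types (V W : vfield R) (z : C2 R).

Definition vapp (v : C2 R * C2 R) (g : C2 R -> Cc R) z : Cc R :=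
  v.1.1 * wd (ex1 R) g z + v.1.2 * wd (ex2 R) g z +
  (v.2.1 * wdbar (ex1 R) g z + v.2.2 * wdbar (ex2 R) g z).

Definition vmap (op : (C2 R -> Cc R) -> Cc R) V : C2 R * C2 R :=
  ((op (fun z => (V z).1.1), op (fun z => (V z).1.2)),
   (op (fun z => (V z).2.1), op (fun z => (V z).2.2))).

Definition bracket V W : vfield R := fun z =>
  vmap (fun g => vapp (V z) g z) W - vmap (fun g => vapp (W z) g z) V.

Definition vconj V : vfield R := fun z =>
  (((V z).2.1^*, (V z).2.2^*), ((V z).1.1^*, (V z).1.2^*)).

Definition vsmooth_on (U : set (C2 R)) V : Prop :=
  [/\ smooth_on U (fun z => (V z).1.1), smooth_on U (fun z => (V z).1.2),
      smooth_on U (fun z => (V z).2.1) & smooth_on U (fun z => (V z).2.2)].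

End VectorFields.

Section Domain.
Variables (R : realType) (rho : C2 R -> R).
Implicit Types (z p q : C2 R) (X : vfield R) (U : set (C2 R)).

Definition Dom : set (C2 R) := [set z | rho z < 0].

Definition bdry : set (C2 R) := closure Dom `\` interior Dom.

Definition rhoC z : Cc R := (rho z)%:C.

Definition smooth_defining : Prop :=
  smooth_on setT rhoC /\ forall p, bdry p -> exists v, rpd v rhoC p != 0.

(* The real gradient of rho as a vector of C^2 = R^4. *)
Definition grad p : C2 R :=
  (rpd (ex1 R) rhoC p + 'i * rpd ('i *: ex1 R) rhoC p,
   rpd (ex2 R) rhoC p + 'i * rpd ('i *: ex2 R) rhoC p).

Definition bproj z : C2 R :=
  xget 0 [set p | bdry p /\ forall q, bdry q -> eucl_dist z p <= eucl_dist z q].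

Definition bdelta z : R := eucl_dist z (bproj z).

Definition Lfield : vfield R := fun z =>
  ((- wd (ex2 R) rhoC z, wd (ex1 R) rhoC z), (0, 0)).

Definition Lbarfield : vfield R := vconj Lfield.

(* The last condition says that L, Lbar, X span the complexified tangent
   space, which has dimension 3 and is the kernel of d rho. *)
Definition transverse_on U X : Prop :=
  [/\ open U, vsmooth_on U X &
      forall p, U p -> bdry p -> forall v : C2 R * C2 R,
        vapp v rhoC p = 0 <->
        exists a b c : R[i], v = a *: Lfield p + b *: Lbarfield p + c *: X p].

(* The word b :: w stands for the bracket of L (b = false) or Lbar (b = true)
   with the commutator of w; its length is the degree. *)
Fixpoint iter_comm (w : seq bool) : vfield R :=
  match w with
  | [::] => fun=> 0
  | b :: w' =>
      let Lb := if b then Lbarfield else Lfield in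
      if w' is [::] then Lb else bracket Lb (iter_comm w')
  end.

Definition lam_coef X (w : seq bool) q : R[i] :=
  xget 0 [set l | exists a b : R[i],
    iter_comm w q = a *: Lfield q + b *: Lbarfield q + l *: X q].

Definition Lambda X (k : nat) q : R :=
  Num.sqrt (\sum_(1 <= d < k.+1) \sum_(w : d.-tuple bool)
              cmod (lam_coef X w q) ^+ 2).

(* The vanishing of Lambda X k q does not depend on the choice of X. *)
Definition is_type q (k : nat) : Prop :=
  exists U X, [/\ U q, transverse_on U X, (2 <= k)%N, Lambda X k q != 0 &
    forall j : nat, (2 <= j < k)%N -> Lambda X j q = 0].

Definition finite_type_max (m : nat) : Prop :=
  (forall q, bdry q -> exists2 k, is_type q k & (k <= m)%N) /\
  exists2 q, bdry q & is_type q m.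

(* Terms with Lambda X k (bproj z) = 0, which count as +oo, are omitted; the
   set is nonempty when m is the maximal type. *)
Definition Dsize X (m : nat) z : R :=
  inf [set r | exists k : nat, [/\ (2 <= k <= m)%N,
    Lambda X k (bproj z) != 0 &
    r = (bdelta z / Lambda X k (bproj z)) `^ (k%:R^-1)]].

Definition Lambda_pow X (m : nat) (s : R) q : R :=
  \sum_(2 <= k < m.+1) Lambda X k q * s ^+ k.

Definition flat_on_diag (g : C2 R * C2 R -> Cc R) : Prop :=
  forall (vs : seq (C2 R * C2 R)) z, iter_rpd vs g (z, z) = 0.

Definition polarization (Q : C2 R * C2 R -> Cc R) : Prop :=
  [/\ smooth_on setT Q,
      forall z, Q (z, z) = rhoC z,
      flat_on_diag (wdbar (ex1 R, 0) Q),
      flat_on_diag (wdbar (ex2 R, 0) Q) &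
      flat_on_diag (fun zw => Q zw - (Q (zw.2, zw.1))^*)].

Definition admissible X (m : nat) (Q : C2 R * C2 R -> Cc R) p (alpha : R) :
    set (C2 R) :=
  [set z | [/\ Dom z, eucl_dist (bproj z) p < alpha * Dsize X m z &
    cmod (Q (bproj z, p)) < Lambda_pow X m (alpha * Dsize X m z) p]].

Definition comparable1 X m Q p (A : set (C2 R)) : Prop :=
  exists (c C : R) (U : set (C2 R)), [/\ 0 < c, c <= C, nbhs p U,
    admissible X m Q p c `&` U `<=` A `&` U &
    A `&` U `<=` admissible X m Q p C `&` U].

Definition nt_region (beta : R) p : set (C2 R) :=
  [set z | Dom z /\ eucl_dist z p < beta * bdelta z].

Definition nt_limit (f : C2 R -> Cc R) p (l : Cc R) : Prop :=
  forall beta : R, 1 < beta -> f @ within (nt_region beta p) (nbhs p) --> l.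

Definition bvalue (f : C2 R -> Cc R) p : Cc R := xget 0 (nt_limit f p).

Definition boundary_curve (phi : R -> C2 R) : Prop :=
  {within `[0, 1], continuous phi} /\ forall t, t \in `[0, 1] -> bdry (phi t).

End Domain.

(* Main.v *)
(* In fact f(z) tends to l for every approach z -> P = (1, 0) inside Omega.

   A sequence of boundary points converging to P at which the nontangential limit
   fails to exist or is far from l would lie on one boundary curve ending at P; so
   |f - l| has nontangential limits at most eps at all boundary points near P.  In a
   slice z2 = const the domain is, near z1 = 1, the region under the graph of a
   continuous function h, and the bound gives vertical limits at most eps for the
   bounded holomorphic function g = f - l at every point of the graph.

   These pointwise limits are upgraded to unrestricted ones by Baire's theorem: on
   a relatively open piece of the set of bad points the vertical bound holds up to a
   uniform height, and over each complementary interval the maximum principle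
   applies, the two corners being removable and the part of the boundary where only
   |g| <= M is known being damped by the holomorphic barrier
   (1 + sqrt(zeta - z))^-k, which is 1 at the boundary point zeta.  The same barrier
   then gives an estimate independent of the slice.

   The maximum principle is derived from Goursat's theorem for squares, applied to
   (g - g(c))^2 / (z - c): this function is differentiable also at the centre c and
   yields |g(c)| <= C max |g| over the boundary of the square, and powers of g
   remove the constant. *)
Require Import Defs.
From HB Require Import structures.
From mathcomp Require Import all_boot all_order all_algebra.
From mathcomp Require Import complex.
From mathcomp Require Import all_classical all_reals all_analysis.
From mathcomp Require Import ring lra.
Set Implicit Arguments.
Unset Strict Implicit.
Unset Printing Implicit Defensive.
Import Order.TTheory GRing.Theory Num.Theory.
Import numFieldNormedType.Exports.
Local Open Scope classical_set_scope.
Local Open Scope ring_scope.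
Local Open Scope complex_scope.


(** * The modulus and integrals of continuous functions *)

(** The obstacle is uniformity. A vertical limit is attained below a height that depends on the
    point without any control, and every [z] near [P] lies in a slice of its own. Inside a slice,
    Baire's theorem gives a common height only on a portion of the bad set, whose complementary
    intervals may be arbitrarily short, so the barrier estimate must not see their length. It is
    therefore centred at a point [zeta] of the graph that may lie outside the interval in question,
    and its constants depend on a fixed surrounding interval: [c] bounds the real part of
    [sqrt (zeta - z)] from below where only [|g| <= M] is known, [k] is such that
    [e (1 + c)^k >= M], and near [zeta] the remaining loss [(1 + sqrt |zeta - z|)^k] is close to 1.
    From slice to slice the graph and the heights change, whereas [c] and [k] depend only on the
    size of the strip, on [M] and on [e]. The unrestricted bounds inside each slice, which come
    without any rate, thus acquire a common one. *)

Section Modulus.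
Context {R : realType}.
Implicit Types (x y : Cc R).

Lemma cmod0 : cmod (0 : Cc R) = 0.
Proof. exact: ComplexField.Normc.normc0. Qed.

Lemma cmod1 : cmod (1 : Cc R) = 1.
Proof. exact: ComplexField.Normc.normc1. Qed.

Lemma cmod_ge0 x : 0 <= cmod x.
Proof. by case: x => a b; exact: sqrtr_ge0. Qed.

Lemma cmod_eq0 x : (cmod x == 0) = (x == 0).
Proof.
apply/eqP/eqP => [|->]; last exact: cmod0.
exact: ComplexField.Normc.eq0_normc.
Qed.

Lemma cmod_gt0 x : (0 < cmod x) = (x != 0).
Proof. by rewrite lt_neqAle cmod_ge0 andbT eq_sym cmod_eq0. Qed.

Lemma cmodM x y : cmod (x * y) = cmod x * cmod y.
Proof. exact: ComplexField.Normc.normcM. Qed.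

Lemma cmodV x : cmod (x^-1) = (cmod x)^-1.
Proof. exact: ComplexField.Normc.normcV. Qed.

Lemma cmodX x n : cmod (x ^+ n) = cmod x ^+ n.
Proof. by elim: n => [|n IH]; rewrite ?expr0 ?cmod1 // !exprS cmodM IH. Qed.

Lemma cmodN x : cmod (- x) = cmod x.
Proof. exact: normcN. Qed.

Lemma cmodD x y : cmod (x + y) <= cmod x + cmod y.
Proof. exact: le_normcD. Qed.

Lemma cmodB x y : cmod (x - y) <= cmod x + cmod y.
Proof. by rewrite -(cmodN y) cmodD. Qed.

Lemma cmod_distC x y : cmod (x - y) = cmod (y - x).
Proof. by rewrite -cmodN opprB. Qed.

Lemma cmod_triB x y : cmod x - cmod y <= cmod (x - y).
Proof. by rewrite lerBlDr; apply: le_trans (cmodD _ _); rewrite subrK. Qed.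

Lemma cmodE (x : Cc R) : cmod x ^+ 2 = complex.Re x ^+ 2 + complex.Im x ^+ 2.
Proof. by case: x => a b /=; rewrite sqr_sqrtr // addr_ge0 // sqr_ge0. Qed.

Lemma cmod_real (a : R) : cmod (a%:C : Cc R) = `|a|.
Proof. by rewrite /cmod /= expr0n /= addr0 sqrtr_sqr. Qed.

Lemma cmod_nat n : cmod (n%:R : Cc R) = n%:R.
Proof. by rewrite -(rmorph_nat (real_complex R)) cmod_real ger0_norm. Qed.

Lemma Re_le_cmod x : `|complex.Re x| <= cmod x.
Proof.
rewrite -(@ler_pXn2r _ 2) ?nnegrE ?normr_ge0 ?cmod_ge0 //.
by rewrite cmodE real_normK ?num_real // lerDl sqr_ge0.
Qed.

Lemma Im_le_cmod x : `|complex.Im x| <= cmod x.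
Proof.
rewrite -(@ler_pXn2r _ 2) ?nnegrE ?normr_ge0 ?cmod_ge0 //.
by rewrite cmodE (real_normK (num_real _)) lerDr sqr_ge0.
Qed.

Lemma cmod_le_ReIm x : cmod x <= `|complex.Re x| + `|complex.Im x|.
Proof.
rewrite -(@ler_pXn2r _ 2) ?nnegrE ?addr_ge0 ?normr_ge0 ?cmod_ge0 //.
rewrite cmodE sqrrD !real_normK ?num_real // -addrA [leRHS]addrC -addrA.
rewrite [_ + _ ^+ 2]addrC.
have := normr_ge0 (complex.Re x); have := normr_ge0 (complex.Im x).
by nra.
Qed.

Lemma norm_cmod x : `|x| = (cmod x)%:C.
Proof. by case: x. Qed.

Lemma ltc_real (e : R[i]) : 0 < e -> exists2 d : R, 0 < d & e = d%:C.
Proof.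
by case: e => a b; rewrite ltcE /= => /andP[/eqP -> a0]; exists a.
Qed.

Lemma ReB x y : complex.Re (x - y) = complex.Re x - complex.Re y.
Proof. by case: x => ? ?; case: y. Qed.

Lemma ImB x y : complex.Im (x - y) = complex.Im x - complex.Im y.
Proof. by case: x => ? ?; case: y. Qed.

(** The balls of [R[i]] have radii in [R[i]], but a positive element of this partial order is real
    by [ltc_real]; so filters can be handled with real radii throughout. *)
Lemma near_cmodP (z : Cc R) (P : set (Cc R)) :
  (\forall w \near z, P w) <->
  exists2 d : R, 0 < d & forall w, cmod (w - z) < d -> P w.
Proof.
split.
  move/nbhs_ballP => [e /= /ltc_real[d d0 ->] H]; exists d => // w wz.
  by apply: H; rewrite -ball_normE /= norm_cmod ltcR cmod_distC.
move=> [d d0 H]; apply/nbhs_ballP; exists d%:C => /=; first by rewrite ltcR.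
move=> w; rewrite -ball_normE /= norm_cmod ltcR cmod_distC; exact: H.
Qed.

Lemma cvg_cmodP {T : Type} (F : set_system T) {FF : Filter F} (f : T -> Cc R)
    (l : Cc R) :
  f @ F --> l <-> forall e : R, 0 < e -> \forall t \near F, cmod (f t - l) < e.
Proof.
split.
  move/cvgrPdist_lt => H e e0.
  have /H : (0 : R[i]) < e%:C by rewrite ltcR.
  by apply: filterS => t; rewrite norm_cmod ltcR cmod_distC.
move=> H; apply/cvgrPdist_lt => e /ltc_real[d d0 ->].
by apply: filterS (H d d0) => t; rewrite norm_cmod ltcR cmod_distC.
Qed.

End Modulus.

(** * Integrals of continuous functions compared with primitives *)

Section RealPrimitive.
Context {R : realType}.
Notation mu := (@lebesgue_measure R).
Implicit Types (u G p : R -> R) (a b c e : R).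

Lemma cts_integrable u a b : {within `[a, b], continuous u} ->
  mu.-integrable `[a, b] (EFin \o u).
Proof.
by move=> cu; apply: continuous_compact_integrable => //; exact: segment_compact.
Qed.

Lemma integral_split u a b c : a <= b <= c -> {within `[a, c], continuous u} ->
  \int[mu]_(t in `[a, c]) u t =
  \int[mu]_(t in `[a, b]) u t + \int[mu]_(t in `[b, c]) u t.
Proof.
move=> /andP[ab bc] cu.
have iu := cts_integrable cu.
have := @Rintegral_itvB R u (BLeft a) (BRight c) b iu.
rewrite !bnd_simp => /(_ ab bc) H.
apply/eqP; rewrite addrC -subr_eq H; apply/eqP.
apply: Rintegral_itv_obnd_cbnd.
by apply: integrableS iu => //; apply: subset_itvr; rewrite bnd_simp.
Qed.

(** The integral minus the increment of [G], as a function of the upper endpoint, has derivative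
    [u - p]; the mean value theorem bounds it. This is how edge integrals are compared with explicit
    primitives. *)
Lemma integral_approx u G p a b e : a <= b ->
  {within `[a, b], continuous u} -> {within `[a, b], continuous G} ->
  (forall x, x \in `]a, b[ -> is_derive x 1 G (p x)) ->
  (forall x, x \in `]a, b[ -> `|u x - p x| <= e) ->
  `|\int[mu]_(t in `[a, b]) u t - (G b - G a)| <= e * (b - a).
Proof.
rewrite le_eqVlt => /predU1P[-> *|ab cu cG dG ue].
  by rewrite set_itv1 Rintegral_set1 !subrr mulr0 normr0.
have iu := cts_integrable cu.
pose F x := \int[mu]_(t in `[a, x]) u t - G x.
have dF x : x \in `]a, b[ -> is_derive x 1 F (u x - p x).
  move=> xab.
  have [ax xb] : a < x /\ x < b by move: xab; rewrite in_itv => /andP.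
  have cux : {for x, continuous u}.
    by have /(continuous_within_itvP _ ab)[cin _ _] := cu; exact: cin.
  have [D E] := @continuous_FTC1_closed R u a x b xb iu ax cux.
  rewrite derive1E in E; rewrite -E.
  have := dG _ xab => ?; apply: is_deriveB; exact: derivableP.
have cF : {within `[a, b], continuous F}.
  move=> x; apply: (@continuousB _ _ (subspace `[a, b])
    (fun x => \int[mu]_(t in `[a, x]) u t) G); last exact: cG.
  exact: (parameterized_integral_continuous (ltW ab) iu).
have [c cab] := MVT ab dF cF.
rewrite /F set_itv1 Rintegral_set1 sub0r => E.
have -> : \int[mu]_(t in `[a, b]) u t - (G b - G a) = (u c - p c) * (b - a).
  by rewrite -E; ring.
rewrite normrM (gtr0_norm (x:=b - a)) ?subr_gt0 //.
by apply: ler_wpM2r; [rewrite subr_ge0 ltW | exact: ue].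
Qed.

End RealPrimitive.


(** * Goursat's theorem for squares *)

Section Calculus.
Context {R : realType}.
Implicit Types (g : Cc R -> Cc R) (x y s a b e r : R) (z : Cc R).

Lemma cts_Re : continuous (@complex.Re R : Cc R -> R).
Proof.
move=> z; apply/(@cvgrPdist_lt _ _ _ (nbhs z) (nbhs_filter z)) => e e0;
apply/near_cmodP; exists e => // w wz.
by rewrite distrC -ReB (le_lt_trans (Re_le_cmod _)).
Qed.

Lemma cts_Im : continuous (@complex.Im R : Cc R -> R).
Proof.
move=> z; apply/(@cvgrPdist_lt _ _ _ (nbhs z) (nbhs_filter z)) => e e0;
apply/near_cmodP; exists e => // w wz.
by rewrite distrC -ImB (le_lt_trans (Im_le_cmod _)).
Qed.

Lemma cvg_Complex {T : Type} (F : set_system T) {FF : Filter F} (u v : T -> R)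
    (a b : R) :
  u @ F --> a -> v @ F --> b ->
  (fun t => (u t +i* v t : Cc R)) @ F --> (a +i* b : Cc R).
Proof.
move=> ua vb; apply/cvg_cmodP => e e0.
have e20 : 0 < e / 2 by rewrite divr_gt0.
move/cvgrPdist_lt : ua => /(_ _ e20) ua; move/cvgrPdist_lt : vb => /(_ _ e20) vb.
apply: filterS2 ua vb => t ut vt.
rewrite (le_lt_trans (cmod_le_ReIm _)) //= (splitr e) ltrD //.
  by rewrite distrC.
by rewrite distrC.
Qed.

Lemma cmod_cts : continuous (@cmod R).
Proof.
move=> z; apply/(@cvgrPdist_lt _ _ _ (nbhs z) (nbhs_filter z)) => e e0;
apply/near_cmodP; exists e => // w wz.
by apply: le_lt_trans wz; rewrite ler_norml lerNl opprB cmod_triB cmod_distC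
  cmod_triB.
Qed.

Lemma derivable_expansion g z : derivable g z 1 ->
  exists d, forall e, 0 < e -> exists2 del : R, 0 < del &
    forall w, cmod (w - z) < del ->
      cmod (g w - g z - d * (w - z)) <= e * cmod (w - z).
Proof.
move=> /cvg_ex[d /cvg_cmodP H]; exists d => e e0.
have /near_cmodP[del del0 {}H] := H e e0; exists del => // w wz.
have [->|wz0] := eqVneq w z; first by rewrite !subrr mulr0 subrr cmod0 mulr0.
have h0 : w - z != 0 by rewrite subr_eq0.
have := H (w - z).
rewrite subr0 => /(_ wz h0) /=; rewrite !scaler1 subrK => /ltW.
move=> ge.
rewrite [X in cmod X](_ : _ = ((w - z)^-1 *: (g w - g z) - d) * (w - z)).
  by rewrite cmodM ler_wpM2r // cmod_ge0.
by rewrite mulrBl -[_ *: _]/(_ * _) mulrAC mulVf // mul1r.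
Qed.

Lemma derivable_cts g z : derivable g z 1 -> {for z, continuous g}.
Proof. by move=> /derivable1_diffP/differentiable_continuous. Qed.

(** The integral in the real parameter, taken componentwise; the factor ['i] of a vertical edge is
    supplied in [square_integral]. *)
Definition edge (w : R -> Cc R) a b : Cc R :=
  (\int[lebesgue_measure]_(t in `[a, b]) complex.Re (w t)) +i*
  (\int[lebesgue_measure]_(t in `[a, b]) complex.Im (w t)).

(** The counterclockwise contour integral: bottom, right, top reversed, left reversed. *)
Definition square_integral g x y s : Cc R :=
  edge (fun t => g (t +i* y)) x (x + s) +
  'i * edge (fun t => g ((x + s) +i* t)) y (y + s) -
  edge (fun t => g (t +i* (y + s))) x (x + s) -
  'i * edge (fun t => g (x +i* t)) y (y + s).

Lemma edge_split (w : R -> Cc R) a b c : a <= b <= c ->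
  {within `[a, c], continuous (@complex.Re R \o w)} ->
  {within `[a, c], continuous (@complex.Im R \o w)} ->
  edge w a c = edge w a b + edge w b c.
Proof.
by move=> abc cR cI; rewrite /edge (integral_split abc cR) (integral_split abc cI).
Qed.

(** The factor 2 comes from estimating real and imaginary parts separately. *)
Lemma edge_approx (w G p : R -> Cc R) a b e : a <= b ->
  {within `[a, b], continuous (@complex.Re R \o w)} ->
  {within `[a, b], continuous (@complex.Im R \o w)} ->
  (forall t : R, is_derive t 1 (@complex.Re R \o G) (complex.Re (p t))) ->
  (forall t : R, is_derive t 1 (@complex.Im R \o G) (complex.Im (p t))) ->
  (forall t, t \in `[a, b] -> cmod (w t - p t) <= e) ->
  cmod (edge w a b - (G b - G a)) <= 2 * (e * (b - a)).
Proof.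
move=> ab cR cI dR dI we.
have sub t : t \in `]a, b[ -> t \in `[a, b].
  by rewrite !in_itv /= => /andP[/ltW -> /ltW ->].
have cts (H q : R -> R) : (forall t : R, is_derive t 1 H (q t)) ->
    {within `[a, b], continuous H}.
  move=> dH; apply: continuous_subspaceT => t.
  by apply: differentiable_continuous; apply/derivable1_diffP; have [] := dH t.
apply: le_trans (cmod_le_ReIm _) _.
rewrite mulr_natl mulr2n; apply: lerD.
  rewrite !ReB; apply: (integral_approx ab cR (cts _ _ dR)) => t tab.
  by rewrite /= -ReB (le_trans (Re_le_cmod _)) // we // sub.
rewrite !ImB; apply: (integral_approx ab cI (cts _ _ dI)) => t tab.
by rewrite /= -ImB (le_trans (Im_le_cmod _)) // we // sub.
Qed.

Definition in_square x y s z : Prop :=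
  x <= complex.Re z <= x + s /\ y <= complex.Im z <= y + s.

Lemma horizontal_cts g a b y :
  (forall t, t \in `[a, b] -> {for (t +i* y : Cc R), continuous g}) ->
  {within `[a, b], continuous (@complex.Re R \o (fun t => g (t +i* y)))} /\
  {within `[a, b], continuous (@complex.Im R \o (fun t => g (t +i* y)))}.
Proof.
move=> cg.
have ct t : t \in `[a, b] -> {for t, continuous (fun t => g (t +i* y))}.
  move=> tab; apply: (@continuous_comp _ _ _ (fun t : R => (t +i* y : Cc R)) g).
    by apply: cvg_Complex; [exact: cvg_id|exact: cvg_cst].
  exact: cg.
split; apply: continuous_in_subspaceT => t; rewrite inE => /ct c.
  by apply: continuous_comp; [exact: c|exact: cts_Re].
by apply: continuous_comp; [exact: c|exact: cts_Im].
Qed.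

Lemma vertical_cts g a b x :
  (forall t, t \in `[a, b] -> {for (x +i* t : Cc R), continuous g}) ->
  {within `[a, b], continuous (@complex.Re R \o (fun t => g (x +i* t)))} /\
  {within `[a, b], continuous (@complex.Im R \o (fun t => g (x +i* t)))}.
Proof.
move=> cg.
have ct t : t \in `[a, b] -> {for t, continuous (fun t => g (x +i* t))}.
  move=> tab; apply: (@continuous_comp _ _ _ (fun t : R => (x +i* t : Cc R)) g).
    by apply: cvg_Complex; [exact: cvg_cst|exact: cvg_id].
  exact: cg.
split; apply: continuous_in_subspaceT => t; rewrite inE => /ct c.
  by apply: continuous_comp; [exact: c|exact: cts_Re].
by apply: continuous_comp; [exact: c|exact: cts_Im].
Qed.

(** Each outer edge splits into two halves, and the inner edges of the four quarters cancel in
    pairs. *)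
Lemma square_integral_quarter g x y s : 0 <= s ->
  (forall z, in_square x y (s + s) z -> {for z, continuous g}) ->
  square_integral g x y (s + s) =
  square_integral g x y s + square_integral g (x + s) y s +
  (square_integral g x (y + s) s + square_integral g (x + s) (y + s) s).
Proof.
move=> s0 cg.
have split3 (a : R) : a <= a + s <= a + (s + s).
  by rewrite lerDl s0 lerD2l lerDl.
have H y' : y <= y' <= y + (s + s) ->
    edge (fun t => g (t +i* y')) x (x + (s + s)) =
    edge (fun t => g (t +i* y')) x (x + s) +
    edge (fun t => g (t +i* y')) (x + s) (x + (s + s)).
  move=> hy; have [|cR cI] := @horizontal_cts g x (x + (s + s)) y'.
    by move=> t; rewrite in_itv /= => ht; apply: cg.
  exact: edge_split.
have V x' : x <= x' <= x + (s + s) ->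
    edge (fun t => g (x' +i* t)) y (y + (s + s)) =
    edge (fun t => g (x' +i* t)) y (y + s) +
    edge (fun t => g (x' +i* t)) (y + s) (y + (s + s)).
  move=> hx; have [|cR cI] := @vertical_cts g y (y + (s + s)) x'.
    by move=> t; rewrite in_itv /= => ht; apply: cg.
  exact: edge_split.
have b1 (a : R) : a <= a <= a + (s + s) by rewrite lexx lerDl addr_ge0.
have b2 (a : R) : a <= a + (s + s) <= a + (s + s) by rewrite lexx lerDl addr_ge0.
rewrite /square_integral.
rewrite (H y) // (H (y + (s + s))) // (V x) // (V (x + (s + s))) // !(addrA _ s s).
by ring.
Qed.


Lemma is_derive_eqfun (F G : R -> R) (x dF dG : R) :
  F =1 G -> dF = dG -> is_derive x 1 F dF -> is_derive x 1 G dG.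
Proof. by move=> /funext -> ->. Qed.

Lemma is_derive_quadratic (a b c x : R) :
  is_derive x 1 (fun t => a * t ^+ 2 + b * t + c) (2 * a * x + b).
Proof.
apply: is_derive_eqfun (is_derive_poly (a *: 'X ^+ 2 + b *: 'X + c%:P) x).
  by move=> t; rewrite !hornerE.
by rewrite !derivD !derivZ derivXn derivX derivC !hornerE /=; ring.
Qed.

(* The affine part is the derivative of [A z + B z^2 / 2], whose increments
   along the four edges cancel. *)
Lemma square_integral_affine_approx g x y s A B e : 0 <= s ->
  (forall z, in_square x y s z -> {for z, continuous g}) ->
  (forall z, in_square x y s z -> cmod (g z - (A + B * z)) <= e) ->
  cmod (square_integral g x y s) <= 8 * (e * s).
Proof.
move=> s0 cg ge; pose P z : Cc R := A * z + B * z ^+ 2 / 2.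
have bl (a : R) : a <= a <= a + s by rewrite lexx lerDl.
have br (a : R) : a <= a + s <= a + s by rewrite lexx lerDl s0.
have H y' : y <= y' <= y + s ->
    cmod (edge (fun t => g (t +i* y')) x (x + s) -
          (P ((x + s) +i* y') - P (x +i* y'))) <= 2 * (e * s).
  move=> hy; have [|cR cI] := @horizontal_cts g x (x + s) y'.
    by move=> t; rewrite in_itv /= => ht; apply: cg.
  have -> : e * s = e * ((x + s) - x) by congr (_ * _); ring.
  apply: (edge_approx (p := fun t => A + B * (t +i* y'))
    (G := fun t => P (t +i* y'))) => //; first by rewrite lerDl.
  - move=> t.
    apply: (is_derive_eqfun _ _ (is_derive_quadratic (complex.Re B / 2)
      (complex.Re A - complex.Im B * y')
      (- complex.Im A * y' - complex.Re B * y' ^+ 2 / 2) t)).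
      by move=> u; case: A B @P {ge} => [a1 a2] [b1 b2] P; rewrite /P /=; simpc => /=; field.
    by case: A B @P {ge} => [a1 a2] [b1 b2] P /=; simpc => /=; field.
  - move=> t.
    apply: (is_derive_eqfun _ _ (is_derive_quadratic (complex.Im B / 2)
      (complex.Im A + complex.Re B * y')
      (complex.Re A * y' - complex.Im B * y' ^+ 2 / 2) t)).
      by move=> u; case: A B @P {ge} => [a1 a2] [b1 b2] P; rewrite /P /=; simpc => /=; field.
    by case: A B @P {ge} => [a1 a2] [b1 b2] P /=; simpc => /=; field.
  - by move=> t; rewrite in_itv /= => ht; apply: ge.
have V x' : x <= x' <= x + s ->
    cmod ('i * edge (fun t => g (x' +i* t)) y (y + s) -
          (P (x' +i* (y + s)) - P (x' +i* y))) <= 2 * (e * s).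
  move=> hx; have [|cR cI] := @vertical_cts g y (y + s) x'.
    by move=> t; rewrite in_itv /= => ht; apply: cg.
  have -> : e * s = e * ((y + s) - y) by congr (_ * _); ring.
  set E := edge _ _ _.
  (* Since [P (x' + i t)] has derivative ['i * (A + B z)] in [t], the primitive of the affine
     function itself along a vertical edge is [- 'i * P]. *)
  have -> : 'i * E - (P (x' +i* (y + s)) - P (x' +i* y)) =
    'i * (E - ((- 'i * P (x' +i* (y + s))) - (- 'i * P (x' +i* y)))).
    have ii : 'i * 'i = -1 :> Cc R by rewrite -expr2 sqr_i.
    by rewrite !mulrBr !mulNr !mulrN !mulrA ii; ring.
  rewrite cmodM [cmod 'i](_ : _ = 1) ?mul1r; last first.
    by rewrite /cmod /= expr0n expr1n /= add0r sqrtr1.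
  apply: (edge_approx (p := fun t => A + B * (x' +i* t))
    (G := fun t => - 'i * P (x' +i* t))) => //; first by rewrite lerDl.
  - move=> t.
    apply: (is_derive_eqfun _ _ (is_derive_quadratic (- complex.Im B / 2)
      (complex.Re A + complex.Re B * x')
      (complex.Im A * x' + complex.Im B * x' ^+ 2 / 2) t)).
      by move=> u; case: A B @P @E {ge H} => [a1 a2] [b1 b2] P E; rewrite /P /=; simpc => /=; field.
    by case: A B @P @E {ge H} => [a1 a2] [b1 b2] P E /=; simpc => /=; field.
  - move=> t.
    apply: (is_derive_eqfun _ _ (is_derive_quadratic (complex.Re B / 2)
      (complex.Im A + complex.Im B * x')
      (- complex.Re A * x' - complex.Re B * x' ^+ 2 / 2) t)).
      by move=> u; case: A B @P @E {ge H} => [a1 a2] [b1 b2] P E; rewrite /P /=; simpc => /=; field.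
    by case: A B @P @E {ge H} => [a1 a2] [b1 b2] P E /=; simpc => /=; field.
  - by move=> t; rewrite in_itv /= => ht; apply: ge.
have := H y (bl y); have := H (y + s) (br y).
have := V x (bl x); have := V (x + s) (br x).
rewrite /square_integral.
set e1 := 'i * _; set e2 := 'i * _; set e3 := edge _ _ _; set e4 := edge _ _ _.
set p1 := P _; set p2 := P _; set p3 := P _; set p4 := P _ => h1 h2 h3 h4.
(* The corner values of [P] cancel around the square, leaving four errors of size [2 * (e * s)]. *)
rewrite [X in cmod X](_ : _ = (e4 - (p2 - p4)) + (e1 - (p1 - p2)) -
  (e3 - (p1 - p3)) - (e2 - (p3 - p4))); last by ring.
apply: le_trans (cmodB _ _) _.
have := cmodB (e4 - (p2 - p4) + (e1 - (p1 - p2))) (e3 - (p1 - p3)).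
have := cmodD (e4 - (p2 - p4)) (e1 - (p1 - p2)).
by lra.
Qed.

Lemma nested_intervals (u h : nat -> R) :
  (forall n, u n <= u n.+1) -> (forall n, u n.+1 + h n.+1 <= u n + h n) ->
  (forall n, 0 <= h n) -> exists p, forall n, u n <= p <= u n + h n.
Proof.
move=> uS vS h0.
have um m n : (m <= n)%N -> u m <= u n.
  by apply: (@homo_leq _ u (fun x y => x <= y)) => // a b c; exact: le_trans.
have vm m n : (m <= n)%N -> u n + h n <= u m + h m.
  apply: (@homo_leq _ (fun k => u k + h k) (fun x y => y <= x)) => // a b c ab bc.
  exact: le_trans bc ab.
have uv m n : u m <= u n + h n.
  have [mn|/ltnW nm] := leqP m n.
    by rewrite (le_trans (um _ _ mn)) // lerDl.
  by apply: le_trans (vm _ _ nm); rewrite lerDl.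
exists (sup (range u)) => n; apply/andP; split.
  apply: ub_le_sup; last by exists n.
  by exists (u 0%N + h 0%N) => _ [m _ <-].
by apply: ge_sup => [|_ [m _ <-] //]; exists (u 0%N), 0%N.
Qed.

(** Bisection, keeping a quarter whose integral is large relative to its area, contradicts the
    first-order expansion at the limit point. Nothing beyond pointwise differentiability is assumed,
    which is what is known at the centre in [derivable_removable]. *)
Lemma goursat_square g x y s : 0 < s ->
  (forall z, in_square x y s z -> derivable g z 1) ->
  square_integral g x y s = 0.
Proof.
move=> s0 dg; apply/eqP; apply: contraT; rewrite -cmod_gt0 => I0.
have cg z : in_square x y s z -> {for z, continuous g}.
  by move/dg/derivable_cts.
(* Half of the initial ratio of integral to area, so that [big 0] is a strict inequality. *)
pose e := cmod (square_integral g x y s) / (2 * s ^+ 2).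
have e0 : 0 < e by rewrite divr_gt0 // mulr_gt0 // exprn_gt0.
pose h n : R := s / 2 ^+ n.
have hS n : h n = h n.+1 + h n.+1.
  by rewrite /h exprS; field; rewrite expf_neq0.
have h0 n : 0 < h n by rewrite divr_gt0 // exprn_gt0.
pose big n (c : R * R) := e * h n ^+ 2 < cmod (square_integral g c.1 c.2 (h n)).
pose ins n (c : R * R) := x <= c.1 /\ c.1 + h n <= x + s /\ y <= c.2 /\ c.2 + h n <= y + s.
pose step n (c d : R * R) := (d.1 = c.1 \/ d.1 = c.1 + h n.+1) /\
  (d.2 = c.2 \/ d.2 = c.2 + h n.+1).
have next n c : ins n c -> big n c -> exists d, step n c d /\ big n.+1 d.
  move=> [i1 [i2 [i3 i4]]]; rewrite /big.
  rewrite hS square_integral_quarter ?ltW //; last first.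
    move=> z [/andP[z1 z2] /andP[z3 z4]]; apply: cg; split.
      by rewrite -hS in z2; apply/andP; split; lra.
    by rewrite -hS in z4; apply/andP; split; lra.
  set q1 := square_integral _ _ _ _; set q2 := square_integral _ _ _ _.
  set q3 := square_integral _ _ _ _; set q4 := square_integral _ _ _ _ => ltq.
  have := cmodD (q1 + q2) (q3 + q4); have := cmodD q1 q2; have := cmodD q3 q4.
  have [l1|l1] := ltP (e * h n.+1 ^+ 2) (cmod q1).
    by exists c; split => //; split; left.
  have [l2|l2] := ltP (e * h n.+1 ^+ 2) (cmod q2).
    by exists (c.1 + h n.+1, c.2); split => //; split; [right|left].
  have [l3|l3] := ltP (e * h n.+1 ^+ 2) (cmod q3).
    by exists (c.1, c.2 + h n.+1); split => //; split; [left|right].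
  have [l4|l4] := ltP (e * h n.+1 ^+ 2) (cmod q4).
    by exists (c.1 + h n.+1, c.2 + h n.+1); split => //; split; right.
  have E : e * (h n.+1 + h n.+1) ^+ 2 = 4 * (e * h n.+1 ^+ 2) by ring.
  rewrite E in ltq => c1 c2 c3; exfalso; move: c1 c2 c3 ltq l1 l2 l3 l4; clear.
  move: (e * _) (cmod (q1 + q2 + _)) (cmod (q1 + q2)) (cmod (q3 + q4)).
  by move: (cmod q1) (cmod q2) (cmod q3) (cmod q4) => *; lra.
pose nx n c := xget c [set d | step n c d /\ big n.+1 d].
pose fix cn n := if n is n'.+1 then nx n' (cn n') else (x, y).
have cnP n : ins n (cn n) /\ big n (cn n).
  elim: n => [|n [IH1 IH2]].
    split; first by rewrite /ins /h expr0 divr1 !lexx.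
    rewrite /big /h expr0 divr1 /e /=.
    have -> : forall c : R, c / (2 * s ^+ 2) * s ^+ 2 = c / 2.
      by move=> c; field; rewrite gt_eqF.
    by rewrite ltr_pdivrMr // ltr_pMr // ltr1n.
  have [d dP] := next n _ IH1 IH2.
  have [[s1 s2] B] : step n (cn n) (cn n.+1) /\ big n.+1 (cn n.+1).
    by rewrite /= /nx; case: xgetP => [d' -> //|/(_ d)].
  split => //; case: IH1 => [i1 [i2 [i3 i4]]]; rewrite hS in i2 i4.
  have := h0 n.+1; rewrite /ins; clear - i1 i2 i3 i4 s1 s2.
  by case: s1 => ->; case: s2 => -> ?; repeat split; lra.
have cnS n : step n (cn n) (cn n.+1).
  have [i b] := cnP n; have [d dP] := next n _ i b.
  by rewrite /= /nx; case: xgetP => [d' -> [] //|/(_ d)].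
have [p1 p1P] : exists p, forall n, (cn n).1 <= p <= (cn n).1 + h n.
  apply: nested_intervals => n; last exact: ltW.
    by have := h0 n.+1; have [[-> | ->] _] := cnS n => ?; lra.
  by have := h0 n.+1; rewrite (hS n); have [[-> | ->] _] := cnS n => ?; lra.
have [p2 p2P] : exists p, forall n, (cn n).2 <= p <= (cn n).2 + h n.
  apply: nested_intervals => n; last exact: ltW.
    by have := h0 n.+1; have [_ [-> | ->]] := cnS n => ?; lra.
  by have := h0 n.+1; rewrite (hS n); have [_ [-> | ->]] := cnS n => ?; lra.
pose p : Cc R := p1 +i* p2.
have pin : in_square x y s p.
  have := p1P 0%N; have := p2P 0%N; rewrite /in_square /h /= expr0 divr1.
  by move=> -> ->.
(* On a square of side [h] containing [p] distances to [p] are at most [2 h], and the affine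
   estimate gives [8 * (e / 16 * (2 * h) * h) = e * h ^+ 2], against [big]. *)
have [d /(_ (e / 16))[|del del0 dP]] := derivable_expansion (dg _ pin).
  by rewrite divr_gt0.
have [n hn] : exists n, 2 * h n < del.
  have := @cvg_geometric R (2 * s) (2^-1).
  rewrite ger0_norm ?invr_ge0 // => /(_ _)/cvgrPdist_lt => /(_ _ _ del0) [|n _ /(_ n)].
    by rewrite invf_lt1 // ltr1n.
  move=> /(_ (leqnn n)) /=; rewrite sub0r normrN ger0_norm; last first.
    by rewrite mulr_ge0 ?exprn_ge0 ?mulr_ge0 ?invr_ge0 // ltW.
  by move=> ?; exists n; rewrite /h mulrA -exprVn.
have [[i1 [i2 [i3 i4]]] B] := cnP n.
have dist w : in_square (cn n).1 (cn n).2 (h n) w -> cmod (w - p) <= 2 * h n.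
  move=> [/andP[w1 w2] /andP[w3 w4]]; apply: le_trans (cmod_le_ReIm _) _.
  rewrite ReB ImB /= mulr_natl mulr2n; have /andP[? ?] := p1P n; have /andP[? ?] := p2P n.
  by apply: lerD; rewrite ler_norml; lra.
have le : cmod (square_integral g (cn n).1 (cn n).2 (h n)) <=
    8 * (e / 16 * (2 * h n) * h n).
  apply: (@square_integral_affine_approx _ _ _ _ (g p - d * p) d) => [|z|z zn].
  - exact/ltW.
  - move=> [/andP[z1 z2] /andP[z3 z4]]; clear - cg z1 z2 z3 z4 i1 i2 i3 i4.
    by apply: cg; split; apply/andP; split; lra.
  - rewrite [X in cmod X](_ : _ = g z - g p - d * (z - p)); last by ring.
    apply: le_trans (dP z _) _; first by rewrite (le_lt_trans (dist _ zn)).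
    by rewrite ler_pM2l ?dist // divr_gt0.
move: B; rewrite /big ltNge; apply: contraNT => _.
by apply: le_trans le _; rewrite le_eqVlt; apply/orP; left; apply/eqP; field.
Qed.

End Calculus.


(** * The maximum principle *)

Section SquareCenter.
Context {R : realType}.
Implicit Types (g : Cc R -> Cc R) (a b r m t : R) (z c : Cc R).

(** Together with [is_derive_atan_scaled], this gives up to signs the real and imaginary parts of a
    logarithm of [z - c] along an edge at distance [r] from [c], hence a primitive of
    [1 / (z - c)]. *)
Lemma is_derive_half_ln r a t : 0 < r ->
  is_derive t 1 (fun t => ln (r ^+ 2 + (t - a) ^+ 2) / 2)
    ((t - a) / (r ^+ 2 + (t - a) ^+ 2)).
Proof.
move=> r0; pose q t := 1 * t ^+ 2 + (- 2 * a) * t + (a ^+ 2 + r ^+ 2).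
have qE u : q u = r ^+ 2 + (u - a) ^+ 2 by rewrite /q; ring.
have q0 : 0 < q t by rewrite qE ltr_pwDl ?exprn_gt0 // sqr_ge0.
have dq := is_derive_quadratic 1 (- 2 * a) (a ^+ 2 + r ^+ 2) t.
have dl := is_derive1_comp (is_derive1_ln q0) dq.
have dm := is_deriveZ (2^-1) dl.
apply: is_derive_eqfun dm => [u|].
  by rewrite [RHS]mulrC -qE.
by rewrite -qE /GRing.scale /=; field; rewrite gt_eqF.
Qed.

Lemma is_derive_atan_scaled r a t : 0 < r ->
  is_derive t 1 (fun t => atan ((t - a) / r)) (r / (r ^+ 2 + (t - a) ^+ 2)).
Proof.
move=> r0; have dq := is_derive_quadratic 0 r^-1 (- a / r) t.
have dl := is_derive1_comp (is_derive1_atan _) dq.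
have D0 : r ^+ 2 + (t - a) ^+ 2 != 0.
  by rewrite gt_eqF // ltr_pwDl ?exprn_gt0 // sqr_ge0.
apply: is_derive_eqfun dl => [u|] /=.
  by congr atan; field; rewrite gt_eqF.
field; rewrite D0 gt_eqF //= gt_eqF //.
Qed.

Definition square_boundary a b r z : Prop :=
  in_square (a - r) (b - r) (2 * r) z /\
  (`|complex.Re z - a| = r \/ `|complex.Im z - b| = r).

Lemma derivable_sub_cst c z : derivable (fun w : Cc R => w - c) z 1.
Proof.
by have [] := is_derive_shift z 1 (- c).
Qed.

Lemma derivable_affine (a b z : Cc R) : derivable (fun w : Cc R => a + b * w) z 1.
Proof.
have db := derivableM (derivable_cst b z 1) (@derivable_sub_cst 0 z).
rewrite (_ : (fun w => a + b * w) = cst a + cst b * (fun w => w - 0)).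
  exact: derivableD (derivable_cst a z 1) db.
by apply/funext => w; rewrite /cst /= -[(_ + _) w]/(a + b * (w - 0)) subr0.
Qed.

(* The square of [g - 1] absorbs the pole: [(g - 1)^2 / (z - c)] is
   differentiable also at [c], so that its integral vanishes without any limiting
   argument around [c]. *)
Lemma derivable_removable g z c : g c = 1 -> derivable g z 1 ->
  derivable (fun w => (g w - 1) ^+ 2 / (w - c)) z 1.
Proof.
move=> gc dg; have [zc|zc] := eqVneq z c; last first.
  apply: derivableM.
    apply: (@derivableX _ _ (fun w => g w - 1) 2 z 1).
    exact: (derivableB dg (derivable_cst (1 : Cc R) z 1)).
  apply: (@derivableV _ _ (fun w : Cc R => w - c)); first by rewrite subr_eq0.
  exact: derivable_sub_cst.
subst z; move/cvg_ex : dg => [d dP].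
apply/cvg_ex; exists (d ^+ 2).
have FF : Filter ((0 : Cc R)^') := dnbhs_filter _.
have := @cvgM _ _ _ FF _ _ _ _ dP dP; rewrite -expr2 => /cvg_cmodP dP2.
apply/cvg_cmodP => e e0.
have h0 : \forall h \near (0 : Cc R)^', h != 0 by exact: nbhs_dnbhs_neq.
apply: filterS2 (dP2 e e0) h0 => h /[swap] h0.
rewrite /= gc !subrr expr0n /= mul0r subr0 !scaler1 addrK.
set q := g _ - 1.
rewrite -![h^-1 *: _]/(h^-1 * _).
by rewrite [h^-1 * (q ^+ 2 / h)](_ : _ = (h^-1 * q) * (h^-1 * q)); last by field.
Qed.

(** The integral of [(g - 1)^2 / (z - c)] vanishes and that of [1 / (z - c)] is [2 pi i]; on the
    boundary the two integrands differ by at most [(m^2 + 2 m) / r]. Four edges of length [2 r],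
    with the factor 2 of [edge_approx], give [4 <= 2 pi <= 16 (m^2 + 2 m)], which fails for
    [0 <= m < 1/10]. *)
Lemma square_center_lower_bound g a b r m : 0 < r ->
  (forall z, in_square (a - r) (b - r) (2 * r) z -> derivable g z 1) ->
  g (a +i* b) = 1 ->
  (forall z, square_boundary a b r z -> cmod (g z) <= m) -> 10^-1 <= m.
Proof.
move=> r0 dg gc gm; rewrite leNgt; apply/negP => m10.
pose c : Cc R := a +i* b.
pose H w := (g w - 1) ^+ 2 / (w - c).
have dH z : in_square (a - r) (b - r) (2 * r) z -> derivable H z 1.
  by move=> /dg; exact: derivable_removable.
have cH z : in_square (a - r) (b - r) (2 * r) z -> {for z, continuous H}.
  by move=> /dH/derivable_cts.
have r20 : 0 < 2 * r by rewrite mulr_gt0.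
have := goursat_square r20 dH.
rewrite /square_integral.
have E (x : R) : x - r + 2 * r = x + r by ring.
rewrite !E.
have lr (x : R) : x - r <= x + r by lra.
have nr : `|- r| = r by rewrite normrN gtr0_norm.
have pr : `|r| = r by rewrite gtr0_norm.
pose e := (m ^+ 2 + 2 * m) / r.
have err z : square_boundary a b r z -> cmod (H z - (z - c)^-1) <= e.
  move=> zb; have zc : r <= cmod (z - c).
    case: zb => _ [<-|<-].
      by apply: le_trans (Re_le_cmod _); rewrite ReB.
    by apply: le_trans (Im_le_cmod _); rewrite ImB.
  have zc0 : 0 < cmod (z - c) by apply: lt_le_trans zc.
  have zcn : z - c != 0 by rewrite -cmod_gt0.
  rewrite [X in cmod X](_ : _ = (g z ^+ 2 - 2 * g z) / (z - c)); last first.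
    by rewrite /H; field.
  rewrite cmodM cmodV /e; apply: ler_pM; rewrite ?cmod_ge0 ?invr_ge0 ?cmod_ge0 //.
    apply: le_trans (cmodB _ _) _; have gz := gm _ zb.
    rewrite cmodX cmodM cmod_nat.
    apply: lerD; last by rewrite ler_pM2l.
    by rewrite lerXn2r ?nnegrE ?cmod_ge0 // (le_trans (cmod_ge0 _) gz).
  by rewrite lef_pV2 ?posrE.
have hor y' t : `|y' - b| = r -> t \in `[a - r, a + r] -> square_boundary a b r (t +i* y').
  move=> yb; rewrite in_itv /= => tt; split; last by right.
  have : `|y' - b| <= r by rewrite yb.
  by rewrite /in_square /= !E tt ler_norml; split => //; apply/andP; split; lra.
have ver x' t : `|x' - a| = r -> t \in `[b - r, b + r] -> square_boundary a b r (x' +i* t).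
  move=> yb; rewrite in_itv /= => tt; split; last by left.
  have : `|x' - a| <= r by rewrite yb.
  by rewrite /in_square /= !E tt ler_norml; split => //; apply/andP; split; lra.
pose N (x t : R) := ln (r ^+ 2 + (t - x) ^+ 2) / 2.
pose T (x t : R) := atan ((t - x) / r).
have N0 x : N x (x + r) = N x (x - r) by rewrite /N; congr (ln _ / 2); ring.
have T0 x : T x (x + r) - T x (x - r) = pi / 2.
  rewrite /T [x + r - x](_ : _ = r); last by ring.
  rewrite [x - r - x](_ : _ = - r); last by ring.
  by rewrite mulNr divff ?gt_eqF // atanN atan1; field.
have eb : cmod (edge (fun t => H (t +i* (b - r))) (a - r) (a + r) -
    ((N a (a + r) +i* T a (a + r)) - (N a (a - r) +i* T a (a - r)))) <= 2 * (e * (2 * r)).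
  have yb : `|(b - r) - b| = r by rewrite addrAC subrr add0r.
  have [|cR cI] := @horizontal_cts R H (a - r) (a + r) (b - r).
    by move=> t /(hor _ _ yb)[/cH].
  have -> : e * (2 * r) = e * ((a + r) - (a - r)) by congr (_ * _); ring.
  apply: (edge_approx (p := fun t => ((t +i* (b - r)) - c)^-1)
    (G := fun t => (N a t +i* T a t))) => //.
  - move=> t; apply: is_derive_eqfun (is_derive_half_ln a t r0) => //=.
    by congr (_ / _); ring.
  - move=> t; apply: is_derive_eqfun (is_derive_atan_scaled a t r0) => //=.
    by rewrite -mulNr; congr (_ / _); ring.
  - by move=> t /(hor _ _ yb)/err.
have et : cmod (edge (fun t => H (t +i* (b + r))) (a - r) (a + r) -
    ((N a (a + r) +i* (- T a (a + r))) - (N a (a - r) +i* (- T a (a - r))))) <= 2 * (e * (2 * r)).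
  have yb : `|(b + r) - b| = r by rewrite addrAC subrr add0r.
  have [|cR cI] := @horizontal_cts R H (a - r) (a + r) (b + r).
    by move=> t /(hor _ _ yb)[/cH].
  have -> : e * (2 * r) = e * ((a + r) - (a - r)) by congr (_ * _); ring.
  apply: (edge_approx (p := fun t => ((t +i* (b + r)) - c)^-1)
    (G := fun t => (N a t +i* - T a t))) => //.
  - move=> t; apply: is_derive_eqfun (is_derive_half_ln a t r0) => //=.
    by congr (_ / _); ring.
  - move=> t; apply: is_derive_eqfun (is_deriveN (is_derive_atan_scaled a t r0)) => //=.
    by congr (- (_ / _)); ring.
  - by move=> t /(hor _ _ yb)/err.
have er : cmod (edge (fun t => H ((a + r) +i* t)) (b - r) (b + r) -
    ((T b (b + r) +i* (- N b (b + r))) - (T b (b - r) +i* (- N b (b - r))))) <= 2 * (e * (2 * r)).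
  have yb : `|(a + r) - a| = r by rewrite addrAC subrr add0r.
  have [|cR cI] := @vertical_cts R H (b - r) (b + r) (a + r).
    by move=> t /(ver _ _ yb)[/cH].
  have -> : e * (2 * r) = e * ((b + r) - (b - r)) by congr (_ * _); ring.
  apply: (edge_approx (p := fun t => (((a + r) +i* t) - c)^-1)
    (G := fun t => (T b t +i* - N b t))) => //.
  - move=> t; apply: is_derive_eqfun (is_derive_atan_scaled b t r0) => //=.
    by congr (_ / _); ring.
  - move=> t; apply: is_derive_eqfun (is_deriveN (is_derive_half_ln b t r0)) => //=.
    by congr (- (_ / _)); ring.
  - by move=> t /(ver _ _ yb)/err.
have el : cmod (edge (fun t => H ((a - r) +i* t)) (b - r) (b + r) -
    ((- T b (b + r) +i* (- N b (b + r))) - (- T b (b - r) +i* (- N b (b - r)))))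
    <= 2 * (e * (2 * r)).
  have yb : `|(a - r) - a| = r by rewrite addrAC subrr add0r.
  have [|cR cI] := @vertical_cts R H (b - r) (b + r) (a - r).
    by move=> t /(ver _ _ yb)[/cH].
  have -> : e * (2 * r) = e * ((b + r) - (b - r)) by congr (_ * _); ring.
  apply: (edge_approx (p := fun t => (((a - r) +i* t) - c)^-1)
    (G := fun t => (- T b t +i* - N b t))) => //.
  - move=> t; apply: is_derive_eqfun (is_deriveN (is_derive_atan_scaled b t r0)) => //=.
    by rewrite -mulNr; congr (_ / _); ring.
  - move=> t; apply: is_derive_eqfun (is_deriveN (is_derive_half_ln b t r0)) => //=.
    by congr (- (_ / _)); ring.
  - by move=> t /(ver _ _ yb)/err.
move: eb et er el.
set B := edge _ _ _; set T' := edge _ _ _; set Rr := edge _ _ _; set L := edge _ _ _.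
(* On each edge the logarithmic part has equal end values and the angle turns by [pi / 2]; with its
   orientation factor every edge contributes [q]. *)
pose q : Cc R := 0 +i* (pi / 2).
rewrite [X in B - X](_ : _ = q); last by simpc; rewrite N0 subrr T0.
rewrite [X in T' - X](_ : _ = - q); last first.
  by simpc; rewrite N0 subrr -(T0 a) /q; congr (_ +i* _); ring.
rewrite [X in Rr - X](_ : _ = - 'i * q); last first.
  by simpc; rewrite N0 (T0 b) /q; simpc; congr (_ +i* _); ring.
rewrite [X in L - X](_ : _ = 'i * q); last first.
  by simpc; rewrite N0 /q; simpc; rewrite -(T0 b); congr (_ +i* _); ring.
move=> hB hT hR hL I0.
have ci : cmod ('i : Cc R) = 1 by rewrite /cmod /= expr0n expr1n /= add0r sqrtr1.
have ii : 'i * 'i = -1 :> Cc R by rewrite -expr2 sqr_i.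
have K : 4 * q = - ((B - q) + 'i * (Rr - - 'i * q) - (T' - - q) - 'i * (L - 'i * q)).
  move: I0; rewrite !mulrBr !mulNr !mulrN !mulrA ii => I0.
  transitivity (- (B + 'i * Rr - T' - 'i * L) + 4 * q); first by rewrite I0; ring.
  by ring.
have hq : cmod (4 * q) <= 4 * (2 * (e * (2 * r))).
  rewrite K cmodN.
  apply: le_trans (cmodB _ _) _; rewrite cmodM ci mul1r.
  have := cmodB ((B - q) + 'i * (Rr - - 'i * q)) (T' - - q).
  have := cmodD (B - q) ('i * (Rr - - 'i * q)); rewrite cmodM ci mul1r.
  by lra.
have : 4 <= cmod (4 * q).
  apply: le_trans (Im_le_cmod _); rewrite /q.
  have -> : (4 : Cc R) = (4 : R)%:C by rewrite rmorph_nat.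
  simpc => /=; rewrite ger0_norm; have := pi_ge2 R; lra.
have : e * (2 * r) = 2 * (m ^+ 2 + 2 * m) by rewrite /e; field; rewrite gt_eqF.
have : 0 <= m.
  have := gm ((a + r) +i* b); move=> /(_ _)/(le_trans (cmod_ge0 _)); apply.
  apply: ver; first by rewrite addrAC subrr add0r.
  by rewrite in_itv /=; apply/andP; split; lra.
by move=> m0 er4 h4; rewrite er4 in hq; nra.
Qed.

Lemma derivable_pow g n z : derivable g z 1 -> derivable (fun w => g w ^+ n) z 1.
Proof.
move=> dg; elim: n => [|n IH].
  by rewrite (_ : (fun w => g w ^+ 0) = cst 1); [exact: derivable_cst|exact/funext].
rewrite (_ : (fun w => g w ^+ n.+1) = g \* (fun w => g w ^+ n)).
  exact: derivableM dg IH.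
by apply/funext => w; rewrite exprS.
Qed.

Lemma exists_small_power (q d : R) : 0 <= q < 1 -> 0 < d -> exists n, q ^+ n < d.
Proof.
move=> /andP[q0 q1] d0; have := @cvg_geometric R 1 q.
rewrite ger0_norm // => /(_ q1)/cvgrPdist_lt/(_ _ d0)[n _ /(_ n (leqnn n))] /=.
by rewrite sub0r normrN mul1r ger0_norm ?exprn_ge0 //; exists n.
Qed.

(* The bound [1/10] applied to all powers of [g / g(c)]. *)
Lemma square_center_max g a b r m : 0 < r -> 0 <= m ->
  (forall z, in_square (a - r) (b - r) (2 * r) z -> derivable g z 1) ->
  (forall z, square_boundary a b r z -> cmod (g z) <= m) ->
  cmod (g (a +i* b)) <= m.
Proof.
move=> r0 m0 dg gm; rewrite leNgt; apply/negP => mlt.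
set v := g _ in mlt; have v0 : 0 < cmod v by apply: le_lt_trans mlt.
have [||n qn] := @exists_small_power (m / cmod v) (10^-1).
- by rewrite divr_ge0 ?cmod_ge0 //= ltr_pdivrMr // mul1r.
- by rewrite invr_gt0.
suff : 10^-1 <= (m / cmod v) ^+ n by rewrite leNgt qn.
apply: (@square_center_lower_bound (fun z => (v^-1 * g z) ^+ n) a b r _ r0).
- move=> z /dg dz; apply: (derivable_pow (g := fun z => v^-1 * g z)).
  exact: (derivableM (derivable_cst v^-1 z 1) dz).
- by rewrite -/v mulVf ?expr1n // -cmod_gt0.
- move=> z /gm gz; rewrite cmodX cmodM cmodV; apply: lerXn2r.
  + by rewrite nnegrE mulr_ge0 ?invr_ge0 ?cmod_ge0.
  + by rewrite nnegrE divr_ge0 ?cmod_ge0.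
  + by rewrite mulrC ler_pM2r // invr_gt0.
Qed.

End SquareCenter.

(** * From squares to bounded open sets, with finitely many exceptional points *)

Section MaximumPrinciple.
Context {R : realType}.
Implicit Types (Om : set (Cc R)) (G : Cc R -> Cc R) (B e M : R) (z : Cc R).

(* [z0] maximizes [|G z|^2 (1 + eta |z|^2)], and the weight [W z = 1 + eta z0^* z]
   satisfies [(1 + eta |z0|^2) (1 + eta |z|^2) - |W z|^2 = eta |z - z0|^2]; hence
   [|G W|] on a small square around [z0] is strictly below its value at [z0]. *)
Lemma maximum_principle Om G B e : 0 <= e ->
  (forall z, Om z -> exists2 d : R, 0 < d & forall w, cmod (w - z) < d -> Om w) ->
  (forall z, Om z -> `|complex.Re z| <= B /\ `|complex.Im z| <= B) ->
  (forall z, Om z -> derivable G z 1) ->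
  (forall c, ~ Om c -> exists2 d : R, 0 < d &
    forall z, Om z -> cmod (z - c) < d -> cmod (G z) <= e) ->
  forall z, Om z -> cmod (G z) <= e.
Proof.
move=> e0 Oo OB dG Gb z1 Oz1; rewrite leNgt; apply/negP => ev.
have B0 : 0 <= B by have [+ _] := OB _ Oz1; apply: le_trans.
set v := cmod (G z1) in ev.
(* On [Om] the weight is at most [1 + 2 eta B^2]; [eta] is so small that the weighted bound [thr]
   near the boundary stays below [v^2]. *)
have [eta eta0 etaP] : exists2 eta, 0 < eta & e ^+ 2 * (1 + eta * (2 * B ^+ 2)) < v ^+ 2.
  have d0 : 0 < v ^+ 2 - e ^+ 2.
    by rewrite subr_gt0 ltr_pXn2r ?nnegrE // (le_trans e0) // ltW.
  have k0 : 0 < e ^+ 2 * (2 * B ^+ 2) + 1.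
    by rewrite ltr_wpDl // mulr_ge0 ?sqr_ge0 // mulr_ge0 ?sqr_ge0.
  exists ((v ^+ 2 - e ^+ 2) / (e ^+ 2 * (2 * B ^+ 2) + 1)); first exact: divr_gt0.
  rewrite mulrDr mulr1 -ltrBrDl; set k := e ^+ 2 * (2 * B ^+ 2) in k0 *.
  rewrite [ltLHS](_ : _ = (v ^+ 2 - e ^+ 2) * (k / (k + 1))); last first.
    by rewrite /k; field; rewrite gt_eqF.
  by rewrite gtr_pMr // ltr_pdivrMr // mul1r ltrDl.
set thr := e ^+ 2 * _ in etaP.
pose N z := 1 + eta * cmod z ^+ 2.
have N0 z : 0 < N z by rewrite ltr_pwDl // mulr_ge0 ?sqr_ge0 // ltW.
have NB z : Om z -> N z <= 1 + eta * (2 * B ^+ 2).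
  move=> /OB[zr zi]; rewrite lerD2l ler_pM2l // cmodE mulr_natl mulr2n.
  by rewrite lerD // -real_normK ?num_real // lerXn2r ?nnegrE.
(* Truncating the weighted function below at [thr] and extending it by [thr] makes it continuous on
   the whole plane, since near a point outside [Om] it equals [thr]. It then has a maximum on a
   compact box, attained in [Om] because its value at [z1] exceeds [thr]. *)
pose Psi (p : R * R) := if `[< Om (p.1 +i* p.2) >]
  then Num.max thr (cmod (G (p.1 +i* p.2)) ^+ 2 * N (p.1 +i* p.2)) else thr.
have cPsi : continuous Psi.
  move=> p; pose c : Cc R := p.1 +i* p.2.
  have toC : (fun q : R * R => q.1 +i* q.2 : Cc R) @ p --> c.
    by apply: cvg_Complex; [exact: cvg_fst|exact: cvg_snd].
  have [Oc|nOc] := pselect (Om c).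
    have [d d0 dO] := Oo _ Oc.
    have near_Om : \forall q \near p, Om (q.1 +i* q.2).
      apply: (toC Om); apply/near_cmodP; exists d => //.
    have cf : (fun q : R * R => Num.max thr (cmod (G (q.1 +i* q.2)) ^+ 2 * N (q.1 +i* q.2))) @ p -->
        Num.max thr (cmod (G c) ^+ 2 * N c).
      have cmax : (fun z => Num.max thr (cmod (G z) ^+ 2 * N z)) @ c -->
          Num.max thr (cmod (G c) ^+ 2 * N c).
        have cz : cmod z @[z --> c] --> cmod c := @cmod_cts R c.
        have cG : cmod (G z) @[z --> c] --> cmod (G c).
          by apply: continuous_comp; [exact: derivable_cts (dG _ Oc)|exact: cmod_cts].
        apply: (@continuous_max _ (Cc R) (cst thr) (fun z => cmod (G z) ^+ 2 * N z)).
          exact: cst_continuous.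
        have cN : N z @[z --> c] --> N c.
          exact: (cvgD (cvg_cst _) (cvgM (cvg_cst _) (cvgM cz cz))).
        exact: (cvgM (cvgM cG cG) cN).
      by move=> V /cmax/toC.
    rewrite /continuous_at {2}/Psi -/c asboolT //; apply: cvg_trans cf.
    apply: near_eq_cvg; apply: filterS near_Om => q Oq.
    by rewrite /Psi asboolT.
  have [d d0 dP] := Gb _ nOc.
  rewrite /continuous_at {2}/Psi -/c asboolF //.
  apply: cvg_near_cst.
  have : \forall q \near p, cmod ((q.1 +i* q.2) - c) < d.
    by apply: (toC [set z | cmod (z - c) < d]); apply/near_cmodP; exists d.
  apply: filterS => q qd; rewrite /Psi; case: asboolP => // Oq.
  apply/max_idPl; apply: ler_pM; [exact: sqr_ge0|exact: ltW| |exact: NB].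
  by rewrite lerXn2r ?nnegrE ?cmod_ge0 // dP.
pose box := `[- B, B]%classic `*` `[- B, B]%classic : set (R * R).
have inbox z : Om z -> box (complex.Re z, complex.Im z).
  by move=> /OB[]; rewrite /box /= !in_itv /= !ler_norml.
have [|||p0 p0box p0max] := @compact_EVT_max (R * R)%type R Psi box.
- by exists (complex.Re z1, complex.Im z1); exact: inbox.
- by apply: compact_setX; exact: segment_compact.
- exact: continuous_subspaceT.
pose z0 : Cc R := p0.1 +i* p0.2.
have PsiE z : Om z -> Psi (complex.Re z, complex.Im z) = Num.max thr (cmod (G z) ^+ 2 * N z).
  by case: z => x y Oz; rewrite /Psi asboolT.
have Psi1 : thr < Psi p0.
  apply: lt_le_trans (p0max (complex.Re z1, complex.Im z1) _); last by rewrite inE; exact: inbox.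
  rewrite PsiE // lt_max; apply/orP; right; apply: lt_le_trans etaP _.
  by rewrite -/v ler_peMr ?sqr_ge0 // lerDl mulr_ge0 ?sqr_ge0 // ltW.
have [Oz0 Psi0] : Om z0 /\ Psi p0 = cmod (G z0) ^+ 2 * N z0.
  move: Psi1; rewrite /Psi -/z0; case: asboolP => [Oz0|]; last by rewrite ltxx.
  by rewrite lt_max ltxx /= => /ltW/max_idPr ->.
have Gmax z : Om z -> cmod (G z) ^+ 2 * N z <= cmod (G z0) ^+ 2 * N z0.
  move=> Oz; rewrite -Psi0.
  apply: le_trans (p0max (complex.Re z, complex.Im z) _); last by rewrite inE; exact: inbox.
  by rewrite PsiE // le_max lexx orbT.
have Gz0 : 0 < cmod (G z0) ^+ 2 * N z0.
  rewrite -Psi0; apply: le_lt_trans Psi1; rewrite mulr_ge0 ?sqr_ge0 // addr_ge0 //.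
  by rewrite mulr_ge0 ?mulr_ge0 ?sqr_ge0 // ltW.
have [d d0 dO] := Oo _ Oz0.
pose r := d / 3; have r0 : 0 < r by rewrite divr_gt0.
have sqO z : in_square (p0.1 - r) (p0.2 - r) (2 * r) z -> Om z.
  move=> [/andP[h1 h2] /andP[h3 h4]]; apply: dO; apply: le_lt_trans (cmod_le_ReIm _) _.
  rewrite ReB ImB /z0 /=.
  have : `|complex.Re z - p0.1| <= r by rewrite ler_norml; apply/andP; split; lra.
  have : `|complex.Im z - p0.2| <= r by rewrite ler_norml; apply/andP; split; lra.
  by rewrite /r; lra.
pose W z : Cc R := 1 + eta%:C * z0^* * z.
have WE z : cmod (W z) ^+ 2 = N z0 * N z - eta * cmod (z - z0) ^+ 2.
  rewrite /N !cmodE /W; case: z => x y; rewrite /z0; case: (p0) => a b.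
  by simpc => /=; ring.
pose K := 1 + eta * (2 * B ^+ 2).
(* As [N z0 * N z <= K^2] and [|z - z0| >= r] on the boundary of the square, the loss
   [eta |z - z0|^2] absorbs a factor [1 + k]: there [(1 + k) |G W|^2 <= S], while [|G W|^2 = S] at
   the centre. *)
pose k := eta * r ^+ 2 / K ^+ 2.
have K0 : 0 < K by rewrite ltr_pwDl // mulr_ge0 ?mulr_ge0 ?sqr_ge0 // ltW.
have k0 : 0 < k by rewrite divr_gt0 ?exprn_gt0 // mulr_gt0 ?exprn_gt0.
pose S := cmod (G z0) ^+ 2 * N z0 * N z0.
have S0 : 0 < S by rewrite mulr_gt0.
have GW0 : cmod (G z0 * W z0) ^+ 2 = S.
  rewrite cmodM exprMn WE subrr cmod0 expr0n mulr0 subr0 /S; ring.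
suff : cmod (G z0 * W z0) <= Num.sqrt (S / (1 + k)).
  rewrite -(@ler_pXn2r _ 2) ?nnegrE ?cmod_ge0 ?sqrtr_ge0 // GW0.
  rewrite sqr_sqrtr; last by rewrite divr_ge0 ?ltW // addr_gt0.
  by rewrite ler_pdivlMr ?addr_gt0 // mulrDr mulr1 gerDl leNgt mulr_gt0.
apply: (square_center_max (g := fun z => G z * W z) r0 (sqrtr_ge0 _)).
- move=> z /sqO Oz; apply: derivableM; first exact: dG.
  exact: derivable_affine.
- move=> z [/sqO Oz zb].
  have zr : r ^+ 2 <= cmod (z - z0) ^+ 2.
    rewrite lerXn2r ?nnegrE ?cmod_ge0 ?(ltW r0) //; case: zb => [<-|<-].
      by apply: le_trans (Re_le_cmod _); rewrite ReB.
    by apply: le_trans (Im_le_cmod _); rewrite ImB.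
  rewrite -(@ler_pXn2r _ 2) ?nnegrE ?cmod_ge0 ?sqrtr_ge0 //.
  rewrite sqr_sqrtr; last by rewrite divr_ge0 ?ltW // addr_gt0.
  rewrite ler_pdivlMr ?addr_gt0 // cmodM exprMn WE.
  have := Gmax _ Oz; have := sqr_ge0 (cmod (G z)); have := N0 z0; have := N0 z.
  have := NB _ Oz; have := NB _ Oz0; rewrite -/K.
  have hk : k * K ^+ 2 = eta * r ^+ 2 by rewrite /k; field; rewrite gt_eqF.
  rewrite /S; set g2 := cmod (G z) ^+ 2; set D := cmod (z - z0) ^+ 2 in zr *.
  move=> h1 h2 h3 h4 h5 h6.
  have t1 : g2 * N z * N z0 <= cmod (G z0) ^+ 2 * N z0 * N z0 by rewrite ler_pM2r.
  have t2 : g2 * (eta * r ^+ 2) <= g2 * (eta * D) by rewrite ler_wpM2l // ler_pM2l.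
  have t3 : N z0 * N z <= K ^+ 2 by rewrite expr2 ler_pM // ltW.
  have t4 : g2 * k * (N z0 * N z - eta * D) <= g2 * k * K ^+ 2.
    apply: ler_wpM2l; first by rewrite mulr_ge0 // ltW.
    by apply: le_trans t3; rewrite gerBl mulr_ge0 ?sqr_ge0 // ltW.
  have t5 : g2 * k * K ^+ 2 = g2 * (eta * r ^+ 2) by rewrite -mulrA hk.
  by lra.
Qed.

(* The maximum principle for [G^n (z - p)] with [n] tending to infinity disposes of
   the exceptional boundary point [p]. *)
Lemma maximum_principle_exceptional (F : seq (Cc R)) Om G B e M : 0 < e ->
  (forall z, Om z -> exists2 d : R, 0 < d & forall w, cmod (w - z) < d -> Om w) ->
  (forall z, Om z -> `|complex.Re z| <= B /\ `|complex.Im z| <= B) ->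
  (forall z, Om z -> derivable G z 1) ->
  (forall z, Om z -> cmod (G z) <= M) ->
  (forall c, ~ Om c -> c \notin F -> exists2 d : R, 0 < d &
    forall z, Om z -> cmod (z - c) < d -> cmod (G z) <= e) ->
  forall z, Om z -> cmod (G z) <= e.
Proof.
elim: F G e M => [|p F IH] G e M e0 Oo OB dG GM Gb.
  by apply: (maximum_principle (ltW e0) Oo OB dG) => c /Gb; apply.
have [Op|nOp] := pselect (Om p).
  apply: (IH G e M) => // c nOc cF; apply: Gb => //.
  by rewrite inE negb_or cF andbT; apply: contra_notN nOc => /eqP ->.
move=> z Oz; have B0 : 0 <= B by have [+ _] := OB _ Oz; apply: le_trans.
have M0 : 0 <= M by apply: le_trans (GM _ Oz); exact: cmod_ge0.
pose D := B + B + cmod p + 1.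
have D0 : 0 < D by rewrite ltr_wpDl // !addr_ge0 ?cmod_ge0.
have OD w : Om w -> cmod (w - p) <= D.
  move=> /OB[w1 w2]; apply: le_trans (cmodB _ _) _.
  by have := cmod_le_ReIm w; rewrite /D; lra.
have H n : cmod (G z) ^+ n * cmod (z - p) <= e ^+ n * D.
  rewrite -cmodX -cmodM.
  apply: (IH (fun w => G w ^+ n * (w - p)) _ (M ^+ n * D) _ Oo OB _ _ _ z Oz).
  - by rewrite mulr_gt0 // exprn_gt0.
  - move=> w Ow; apply: derivableM; last exact: derivable_sub_cst.
    by apply: derivable_pow; exact: dG.
  - move=> w Ow; rewrite cmodM cmodX ler_pM ?exprn_ge0 ?cmod_ge0 ?OD //.
    by rewrite lerXn2r ?nnegrE ?cmod_ge0 // GM.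
  (* At [p] the factor [w - p] tends to 0 and [|G| <= M] suffices. *)
  - move=> c nOc cF; have [->|cp] := eqVneq c p.
      exists (e ^+ n * D / (M ^+ n + 1)).
        by rewrite divr_gt0 ?mulr_gt0 ?exprn_gt0 // ltr_wpDl ?exprn_ge0.
      move=> w Ow /ltW; rewrite ler_pdivlMr ?ltr_wpDl ?exprn_ge0 // cmodM cmodX.
      apply: le_trans; rewrite mulrC ler_wpM2l ?cmod_ge0 //.
      by rewrite ler_wpDr // lerXn2r ?nnegrE ?cmod_ge0 // GM.
    have [|d d0 dP] := Gb c nOc; first by rewrite inE negb_or cp.
    exists d => // w Ow wc; rewrite cmodM cmodX ler_pM ?exprn_ge0 ?cmod_ge0 ?OD //.
    by rewrite lerXn2r ?nnegrE ?cmod_ge0 ?(ltW e0) // dP.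
have zp : 0 < cmod (z - p).
  by rewrite cmod_gt0 subr_eq0; apply: contra_notN nOp => /eqP <-.
rewrite leNgt; apply/negP => ez; have Gz : 0 < cmod (G z) by apply: lt_trans ez.
have [||n qn] := @exists_small_power R (e / cmod (G z)) (cmod (z - p) / D).
- by rewrite divr_ge0 ?cmod_ge0 ?(ltW e0) //= ltr_pdivrMr // mul1r.
- by rewrite divr_gt0.
have := H n; rewrite leNgt => /negP; apply.
move: qn; rewrite expr_div_n ltr_pdivrMr ?exprn_gt0 // mulrAC ltr_pdivlMr //.
by rewrite [cmod (z - p) * _]mulrC.
Qed.

End MaximumPrinciple.


(** * Boundary limits in a region below a graph *)

Section Barrier.
Context {R : realType}.
Implicit Types (D : set (Cc R)) (g : Cc R -> Cc R) (h : R -> R) (z u w : Cc R).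

Lemma sqrtc_Re_ge0 u : 0 <= complex.Re (sqrtc u).
Proof. by case: u => a b; rewrite /sqrtc /= sqrtr_ge0. Qed.

(** The half-angle formula: it turns a lower bound on [Re (sqrt u)] into a condition free of square
    roots. *)
Lemma sqrtc_Re_sqr u :
  2 * complex.Re (sqrtc u) ^+ 2 = cmod u + complex.Re u.
Proof.
have E := sqr_sqrtc u; move: E; set w := sqrtc u => E.
have : cmod u = cmod w ^+ 2 by rewrite -cmodX E.
rewrite cmodE => ->; rewrite -E; case: w {E} => a b; rewrite expr2; simpc => /=.
by ring.
Qed.

Lemma cmod_sqrtc u : cmod (sqrtc u) = Num.sqrt (cmod u).
Proof.
by rewrite -[in RHS](sqr_sqrtc u) cmodX sqrtr_sqr ger0_norm ?cmod_ge0.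
Qed.

Lemma sqrtc_Re_gt0 u : ~ (complex.Im u = 0 /\ complex.Re u <= 0) ->
  0 < complex.Re (sqrtc u).
Proof.
move=> nu; rewrite lt_neqAle sqrtc_Re_ge0 andbT eq_sym; apply/eqP => r0.
apply: nu; rewrite -(sqr_sqrtc u); case: (sqrtc u) r0 => a b /= ->.
by rewrite mul0r mulr0 addr0 mul0r sub0r oppr_le0 -expr2 sqr_ge0.
Qed.

Lemma cmod_1D_ge u : 0 <= complex.Re u -> 1 + complex.Re u <= cmod (1 + u).
Proof.
move=> u0; apply: le_trans (Re_le_cmod _); case: u u0 => a b /= a0.
by rewrite ger0_norm // addr_ge0.
Qed.

(* The difference quotient of a square root [w] of [u] is [1 / (w + w0)], and
   [|w + w0|] is bounded below because [w] has nonnegative real part. *)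
Lemma derivable_sqrtc u : ~ (complex.Im u = 0 /\ complex.Re u <= 0) ->
  derivable (@sqrtc R : Cc R -> Cc R) u 1.
Proof.
move=> nu; set w0 : Cc R := sqrtc u.
have p0 : 0 < complex.Re w0 by exact: sqrtc_Re_gt0.
have big w : 0 <= complex.Re w -> complex.Re w0 <= cmod (w + w0).
  move=> w1; apply: le_trans (Re_le_cmod _); move: w1 p0; case: w w0 => a b [c d] /= a0 c0.
  by rewrite ger0_norm ?lerDr // addr_ge0 // ltW.
have w00 : w0 != 0 by apply: contraTneq p0 => ->; rewrite ltxx.
apply/cvg_ex; exists ((2 * w0)^-1).
have FF : Filter ((0 : Cc R)^') := dnbhs_filter _.
apply/cvg_cmodP => e e0.
have q0 : 0 < e * (2 * complex.Re w0 ^+ 3) by rewrite mulr_gt0 // mulr_gt0 // exprn_gt0.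
apply/near_cmodP; exists (e * (2 * complex.Re w0 ^+ 3)) => // v; rewrite subr0 => ve v0.
rewrite /= scaler1 -[_ *: _]/(_ * _); set w : Cc R := sqrtc (v + u).
have wp : 0 <= complex.Re w by exact: sqrtc_Re_ge0.
have ww : v = (w - w0) * (w + w0).
  by rewrite -subr_sqr !sqr_sqrtc addrK.
have bw := big _ wp; have cw : 0 < cmod (w + w0) by apply: lt_le_trans bw.
have sw : w + w0 != 0 by rewrite -cmod_gt0.
have v1 : w - w0 != 0 by apply: contraNneq v0 => E; rewrite ww E mul0r.
have -> : v^-1 * (w - sqrtc u) - (2 * w0)^-1 = - v / (2 * w0 * (w + w0) ^+ 2).
  by rewrite ww -/w0; field; rewrite w00 sw v1.
rewrite cmodM cmodN cmodV ltr_pdivrMr; last first.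
  by rewrite cmod_gt0 mulf_neq0 ?expf_neq0 // mulf_neq0 // pnatr_eq0.
apply: lt_le_trans ve _; rewrite ler_pM2l //.
rewrite [leRHS]cmodM [cmod (2 * w0)]cmodM cmodX.
rewrite cmod_nat.
rewrite -mulrA ler_pM2l // exprS ler_pM //.
- exact: ltW.
- by rewrite exprn_ge0 // ltW.
- by apply: le_trans (Re_le_cmod _); exact: ler_norm.
- by rewrite lerXn2r ?nnegrE ?cmod_ge0 // ltW.
Qed.

(** Vacuous for [c] outside the closure of [D], so it can be asked for at all points of the
    complement and not only on the boundary. *)
Definition limsup_le g D (e : R) (c : Cc R) : Prop :=
  forall e', e < e' -> exists2 d : R, 0 < d &
    forall z, D z -> cmod (z - c) < d -> cmod (g z) <= e'.

(* Maximum principle for [g / (1 + sqrt (z0 - z))^k]; since [2 (Re (sqrt u))^2 = |u| + Re u],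
   the denominator exceeds [(1 + c)^k] where [2 c^2 <= |u| + Re u]. *)
Lemma sqrt_barrier (F : seq (Cc R)) D g (B e M c : R) (k : nat) (z0 : Cc R) :
  0 < e -> 0 < c -> M <= e * (1 + c) ^+ k ->
  (forall z, D z -> exists2 d : R, 0 < d & forall w, cmod (w - z) < d -> D w) ->
  (forall z, D z -> `|complex.Re z| <= B /\ `|complex.Im z| <= B) ->
  (forall z, D z -> derivable g z 1) ->
  (forall z, D z -> cmod (g z) <= M) ->
  (forall z, D z -> ~ (complex.Im z = complex.Im z0 /\ complex.Re z0 <= complex.Re z)) ->
  (forall p, ~ D p -> p \notin F -> limsup_le g D e p \/
    exists2 d : R, 0 < d & forall z, D z -> cmod (z - p) < d ->
      2 * c ^+ 2 <= cmod (z0 - z) + complex.Re (z0 - z)) ->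
  forall z, D z -> cmod (g z) <= e * (1 + Num.sqrt (cmod (z0 - z))) ^+ k.
Proof.
move=> e0 c0 Mk Do DB dg gM Dray Db.
pose W z : Cc R := 1 + sqrtc (z0 - z).
have W1 z : 1 + complex.Re (sqrtc (z0 - z)) <= cmod (W z).
  by apply: cmod_1D_ge; exact: sqrtc_Re_ge0.
have W1' z : 1 <= cmod (W z).
  by apply: le_trans (W1 z); rewrite lerDl sqrtc_Re_ge0.
have Wn0 z : W z != 0 by rewrite -cmod_gt0 (lt_le_trans ltr01).
(* [D] misses the horizontal ray to the right of [z0], hence [z0 - z] avoids the cut of the square
   root. *)
have dW z : D z -> derivable W z 1.
  move=> Dz; have nz : ~ (complex.Im (z0 - z) = 0 /\ complex.Re (z0 - z) <= 0).
    rewrite ImB ReB => -[/eqP + zr]; rewrite subr_eq0 => /eqP zi.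
    by apply: (Dray _ Dz); split=> //; rewrite subr_le0 in zr.
  have d1 : differentiable (fun w : Cc R => z0 - w) z.
    apply/derivable1_diffP.
    rewrite (_ : (fun w => z0 - w) = (fun w => z0 + -1 * w)).
      exact: derivable_affine.
    by apply/funext => w; rewrite mulN1r.
  have d2 : differentiable (@sqrtc R : Cc R -> Cc R) (z0 - z).
    by apply/derivable1_diffP; exact: derivable_sqrtc.
  have d3 : derivable (fun w : Cc R => sqrtc (z0 - w) : Cc R) z 1.
    by apply/derivable1_diffP; exact: (differentiable_comp d1 d2).
  exact: (derivableD (derivable_cst (1 : Cc R) z 1) d3).
(* The upper limits only give bounds [e' > e] near the boundary; [e'] is sent to [e] afterwards. *)
have key e' : e < e' -> forall z, D z -> cmod (g z * (W z)^-1 ^+ k) <= e'.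
  move=> ee; have e'0 : 0 < e' by apply: lt_trans ee.
  have M0 z : D z -> 0 <= M by move=> /gM; apply: le_trans; exact: cmod_ge0.
  have GE z : cmod (g z * (W z)^-1 ^+ k) = cmod (g z) / cmod (W z) ^+ k.
    by rewrite cmodM cmodX cmodV exprVn.
  have Wk z : 1 <= cmod (W z) ^+ k by rewrite exprn_ege1.
  have Wk0 z : 0 < cmod (W z) ^+ k by apply: lt_le_trans (Wk z).
  apply: (maximum_principle_exceptional (M := M) e'0 Do DB).
  - move=> z Dz; apply: derivableM; first exact: dg.
    apply: (derivable_pow (g := fun z => (W z)^-1)).
    by apply: derivableV; [exact: Wn0|exact: dW].
  - move=> z Dz; rewrite GE ler_pdivrMr //; apply: le_trans (gM _ Dz) _.
    by rewrite ler_peMr // (M0 _ Dz).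
  - move=> p nDp pF; have [/(_ _ ee)[d d0 dP]|[d d0 dP]] := Db _ nDp pF.
      exists d => // z Dz zp; rewrite GE ler_pdivrMr //; apply: le_trans (dP _ Dz zp) _.
      by rewrite ler_peMr // ltW.
    exists d => // z Dz zp; rewrite GE ler_pdivrMr //.
    apply: le_trans (gM _ Dz) _; apply: le_trans Mk _.
    apply: ler_pM; [exact: ltW|by rewrite exprn_ge0 // addr_ge0 // ltW|exact: ltW|].
    rewrite lerXn2r ?nnegrE ?cmod_ge0 ?addr_ge0 ?(ltW c0) //.
    apply: le_trans (W1 z); rewrite lerD2l.
    rewrite -(@ler_pXn2r _ 2) ?nnegrE ?sqrtc_Re_ge0 ?(ltW c0) //.
    by have := dP _ Dz zp; rewrite -sqrtc_Re_sqr ler_pM2l.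
move=> z Dz; have Wk0 : 0 < cmod (W z) ^+ k.
  by rewrite exprn_gt0 // (lt_le_trans ltr01).
have : cmod (g z * (W z)^-1 ^+ k) <= e.
  by apply/ler_addgt0Pr => x x0; apply: key => //; rewrite ltrDl.
rewrite cmodM cmodX cmodV exprVn ler_pdivrMr // => /le_trans; apply.
rewrite ler_pM2l // lerXn2r ?nnegrE ?cmod_ge0 ?addr_ge0 ?sqrtr_ge0 //.
by apply: le_trans (cmodD _ _) _; rewrite cmod1 cmod_sqrtc.
Qed.

(** The graph lies over the imaginary axis: below it means smaller real part, and vertical approach
    runs parallel to the real axis. *)
Definition graph_strip h (a1 a2 b : R) : set (Cc R) :=
  [set z | a1 < complex.Im z < a2 /\
    h (complex.Im z) - b < complex.Re z < h (complex.Im z)].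

Lemma graph_height_cts h (p : Cc R) (t : R) : continuous h -> 0 < t ->
  exists2 d : R, 0 < d & forall z, cmod (z - p) < d ->
    `|(complex.Re z - h (complex.Im z)) - (complex.Re p - h (complex.Im p))| < t.
Proof.
move=> ch t0; apply/near_cmodP.
have cf : (fun z : Cc R => complex.Re z - h (complex.Im z)) @ p -->
    complex.Re p - h (complex.Im p).
  exact: (cvgB (@cts_Re R p) (cvg_comp _ _ (@cts_Im R p) (ch (complex.Im p)))).
move/(@cvgrPdist_lt _ _ _ (nbhs p) (nbhs_filter p)) : cf => /(_ _ t0).
by apply: filterS => z; rewrite distrC.
Qed.

Lemma graph_strip_open h (a1 a2 b : R) z : continuous h -> graph_strip h a1 a2 b z ->
  exists2 d : R, 0 < d & forall w, cmod (w - z) < d -> graph_strip h a1 a2 b w.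
Proof.
move=> ch [/andP[z1 z2] /andP[z3 z4]].
pose f := complex.Re z - h (complex.Im z).
pose t := Num.min (- f) (f + b).
have t0 : 0 < t by rewrite lt_min; apply/andP; rewrite /f; split; lra.
have [d d0 dP] := graph_height_cts z ch t0.
exists (Num.min d (Num.min (complex.Im z - a1) (a2 - complex.Im z))).
  by rewrite !lt_min d0 !subr_gt0 z1 z2.
move=> w; rewrite !lt_min => /andP[/dP wd /andP[w1 w2]].
have wi : `|complex.Im w - complex.Im z| <= cmod (w - z).
  by rewrite -ImB Im_le_cmod.
move: wi wd; rewrite ler_norml ltr_norml !lt_min -/f => /andP[w3 w4].
move=> /andP[]; rewrite ltrNl lt_min => /andP[h1 h2] /andP[h3 h4].
move: h1 h2 h3 h4; rewrite /f => h1 h2 h3 h4.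
by split; apply/andP; split; lra.
Qed.

(** [sqrt_barrier] centred at the graph point over [y0]. That point only has to lie over [[j1, j2]],
    and the estimate is independent of [a1] and [a2]; this makes it usable on short complementary
    intervals. The condition [4 c^2 <= b] serves the bottom of the strip, the one with [eta] serves
    a side at distance at least [eta] from [y0]. *)
Lemma graph_barrier h g (j1 j2 a1 a2 b eta M e c y0 : R) (k : nat) :
  continuous h -> 0 < b -> 0 < eta -> 0 < e -> 0 < c ->
  4 * c ^+ 2 <= b -> 16 * c ^+ 2 * (j2 - j1 + 2 * b) <= eta ^+ 2 ->
  M <= e * (1 + c) ^+ k -> j1 <= a1 -> a2 <= j2 -> j1 <= y0 <= j2 ->
  (forall y, j1 <= y <= j2 -> `|h y - h y0| <= b / 2) ->
  (forall z, graph_strip h a1 a2 b z -> derivable g z 1) ->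
  (forall z, graph_strip h a1 a2 b z -> cmod (g z) <= M) ->
  (forall y, a1 < y < a2 -> limsup_le g (graph_strip h a1 a2 b) e (h y +i* y)) ->
  (forall y, y = a1 \/ y = a2 -> eta <= `|y - y0| \/
    forall x, h y - b < x < h y -> limsup_le g (graph_strip h a1 a2 b) e (x +i* y)) ->
  forall z, graph_strip h a1 a2 b z ->
    cmod (g z) <= e * (1 + Num.sqrt (cmod ((h y0 +i* y0) - z))) ^+ k.
Proof.
move=> ch b0 eta0 e0 c0 cb ceta Mk ja1 aj2 /andP[jy1 jy2] hb dg gM top sides.
set S := graph_strip h a1 a2 b in dg gM top sides *.
have Sj z : S z -> j1 <= complex.Im z <= j2.
  by move=> [/andP[z1 z2] _]; apply/andP; split; lra.
have Sh z : S z -> `|h y0 - complex.Re z| <= 3 / 2 * b.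
  move=> Sz; have := hb _ (Sj _ Sz); case: Sz => _ /andP[z3 z4].
  by rewrite !ler_norml => /andP[h1 h2]; apply/andP; split; lra.
have St z : S z -> cmod ((h y0 +i* y0) - z) <= j2 - j1 + 2 * b.
  move=> Sz; apply: le_trans (cmod_le_ReIm _) _; rewrite ReB ImB /=.
  have := Sh _ Sz; have /andP[z1 z2] := Sj _ Sz.
  have : `|y0 - complex.Im z| <= j2 - j1 by rewrite ler_norml; apply/andP; split; lra.
  by lra.
have So z : S z -> exists2 d : R, 0 < d & forall w, cmod (w - z) < d -> S w.
  exact: graph_strip_open.
pose B := `|h y0| + 2 * b + `|j1| + `|j2|.
have SB z : S z -> `|complex.Re z| <= B /\ `|complex.Im z| <= B.
  move=> Sz; have := Sh _ Sz; have /andP[z1 z2] := Sj _ Sz.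
  have := ler_norm (h y0); have := ler_norm (- h y0); rewrite normrN.
  have := ler_norm j2; have := ler_norm (- j2); rewrite normrN.
  have := ler_norm j1; have := ler_norm (- j1); rewrite normrN.
  rewrite ler_norml => n1 n2 n3 n4 n5 n6 /andP[n7 n8].
  rewrite /B; clear - z1 z2 n1 n2 n3 n4 n5 n6 n7 n8 b0.
  by split; rewrite ler_norml; apply/andP; split; lra.
have Sray z : S z -> ~ (complex.Im z = complex.Im (h y0 +i* y0) /\
    complex.Re (h y0 +i* y0) <= complex.Re z).
  by move=> [_ /andP[_ z4]] /= [zi zr]; move: z4; rewrite zi ltNge zr.
(* The two upper corners are the exceptional points: neither the hypothesis on the graph nor the one
   on the sides reaches them. *)
apply: (sqrt_barrier (F := [:: h a1 +i* a1; h a2 +i* a2]) e0 c0 Mk So SB dg gM Sray).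
move=> p nSp pF.
have vac d : 0 < d -> (forall z, S z -> cmod (z - p) < d -> False) -> limsup_le g S e p.
  by move=> d0 far e' _; exists d => // z Sz zp; have := far _ Sz zp.
have imd z : `|complex.Im z - complex.Im p| <= cmod (z - p) by rewrite -ImB Im_le_cmod.
have [p1|p1] := ltP (complex.Im p) a1.
  left; apply: (vac (a1 - complex.Im p)); first by rewrite subr_gt0.
  move=> z [/andP[z1 z2] _]; have := imd z; rewrite ler_norml => /andP[].
  by clear - z1 z2; lra.
have [p2|p2] := ltP a2 (complex.Im p).
  left; apply: (vac (complex.Im p - a2)); first by rewrite subr_gt0.
  move=> z [/andP[z1 z2] _]; have := imd z; rewrite ler_norml => /andP[].
  by clear - z1 z2; lra.
pose f := complex.Re p - h (complex.Im p).
have [f1|f1] := ltP 0 f.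
  left; have [d d0 dP] := graph_height_cts p ch f1.
  apply: (vac d d0) => z [_ /andP[z3 z4]] /dP; rewrite ltr_norml -/f => /andP[].
  by clearbody f; clear - z3 z4; lra.
have [f2|f2] := ltP f (- b).
  have f2' : 0 < - b - f by rewrite subr_gt0.
  left; have [d d0 dP] := graph_height_cts p ch f2'.
  apply: (vac d d0) => z [_ /andP[z3 z4]] /dP; rewrite ltr_norml -/f => /andP[].
  by clearbody f; clear - z3 z4; lra.
have pj : j1 <= complex.Im p <= j2.
  by rewrite (le_trans ja1 p1) (le_trans p2 aj2).
(* Bottom: [h] oscillates by at most [b / 2] around [h y0], so within [b / 4] of [p] the real part
   of [u = zeta - z] is at least [b / 4], and [|u| + Re u >= b / 2 >= 2 c^2]. *)
have [f3|f3] := eqVneq f (- b).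
  right; exists (b / 4); first by rewrite divr_gt0.
  move=> z Sz zp; have := hb _ pj; rewrite ler_norml => /andP[q1 q2].
  have : `|complex.Re z - complex.Re p| <= cmod (z - p) by rewrite -ReB Re_le_cmod.
  rewrite ler_norml => /andP[q3 q4].
  have u0 : b / 4 <= complex.Re (h y0 +i* y0 - z).
    by rewrite ReB /=; rewrite /f in f3; clear - f3 q1 q2 q3 q4 zp; lra.
  have := le_trans (ler_norm _) (Re_le_cmod (h y0 +i* y0 - z)).
  by clear - u0 cb; lra.
have f2' : - b < f by rewrite lt_neqAle eq_sym f3.
have side (y : R) : complex.Im p = y -> (y = a1 \/ y = a2) -> limsup_le g S e p \/
    (exists2 d : R, 0 < d & forall z, S z -> cmod (z - p) < d ->
      2 * c ^+ 2 <= cmod (h y0 +i* y0 - z) + complex.Re (h y0 +i* y0 - z)).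
  move=> py ya.
  have f0 : f != 0.
    apply: contraNneq pF => f0; rewrite !inE.
    have -> : p = h y +i* y.
      have := f0; rewrite /f => /eqP; rewrite subr_eq0 -py => /eqP <-.
      by case: (p).
    by case: ya => ->; rewrite eqxx ?orbT.
  have fn : f < 0 by rewrite lt_neqAle f0.
  have [far|near_] := sides _ ya; last first.
    left; have -> : p = complex.Re p +i* y by rewrite -py; case: (p).
    apply: near_; move: fn f2'; rewrite /f py; clear => ? ?.
    by apply/andP; split; lra.
  right; exists (eta / 2); first by rewrite divr_gt0.
  move=> z Sz zp; set u := _ - z.
  have ui : eta / 2 <= `|complex.Im u|.
    have := imd z; rewrite py /u ImB /= distrC => zi.
    have := ler_distD (complex.Im z) y y0.
    by rewrite (distrC y0); move: far zi zp; clear; lra.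
  have T0 : 0 < cmod u.
    by apply: lt_le_trans (Im_le_cmod u); apply: lt_le_trans ui; rewrite divr_gt0.
  have uT : cmod u <= j2 - j1 + 2 * b := St _ Sz.
  have uE := cmodE u.
  have um : cmod u - complex.Re u <= 2 * cmod u.
    have := ler_norm (- complex.Re u); rewrite normrN; have := Re_le_cmod u.
    by clear; lra.
  have up : 0 <= cmod u + complex.Re u.
    have := ler_norm (- complex.Re u); rewrite normrN; have := Re_le_cmod u.
    by clear; lra.
  have i2 : (eta / 2) ^+ 2 <= complex.Im u ^+ 2.
    by rewrite -[leRHS]real_normK ?num_real // lerXn2r ?nnegrE ?normr_ge0 ?divr_ge0 // ltW.
  (* Far side: [(|u| + Re u) (|u| - Re u) = (Im u)^2], where the second factor is at most [2 |u|]
     and [|u|] is bounded by the size of the strip. *)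
  have pr : (eta / 2) ^+ 2 <= (cmod u + complex.Re u) * (2 * cmod u).
    apply: le_trans i2 _.
    have -> : complex.Im u ^+ 2 = (cmod u + complex.Re u) * (cmod u - complex.Re u).
      by rewrite mulrC -subr_sqr uE; ring.
    by rewrite ler_wpM2l.
  rewrite -(@ler_pM2r _ (2 * cmod u)) ?mulr_gt0 //; apply: le_trans pr.
  apply: (@le_trans _ _ (4 * c ^+ 2 * (j2 - j1 + 2 * b))).
    rewrite [leLHS](_ : _ = 4 * c ^+ 2 * cmod u); last by ring.
    by rewrite ler_wpM2l // mulr_ge0 // sqr_ge0.
  by rewrite expr_div_n; clear - ceta; lra.
have [pa1|pa1] := eqVneq (complex.Im p) a1.
  by apply: (side a1 pa1); left.
have [pa2|pa2] := eqVneq (complex.Im p) a2.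
  by apply: (side a2 pa2); right.
have p1' : a1 < complex.Im p by rewrite lt_neqAle eq_sym pa1.
have p2' : complex.Im p < a2 by rewrite lt_neqAle pa2.
have [f0|f0] := eqVneq f 0.
  left; have := top (complex.Im p); rewrite p1' p2' => /(_ isT).
  by move/eqP: f0; rewrite /f subr_eq0 => /eqP <-; case: (p).
exfalso; apply: nSp; split; first by rewrite p1' p2'.
have fn : f < 0 by rewrite lt_neqAle f0.
by rewrite /f in fn f2'; clear - fn f2'; apply/andP; split; lra.
Qed.

(** This and the next two lemmas choose the constants of [graph_barrier]: [c] from the geometry,
    then [k] from [M / e], then the distance to the centre at which the factor [(1 + t)^k], with
    [t = sqrt |zeta - z|], is harmless. *)
Lemma exists_small_square (x y z : R) : 0 < x -> 0 < y -> 0 < z ->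
  exists2 c : R, 0 < c & 4 * c ^+ 2 <= x /\ 16 * c ^+ 2 * y <= z.
Proof.
move=> x0 y0 z0; pose t := Num.min (x / 4) (z / (16 * y)).
have t0 : 0 < t by rewrite lt_min !divr_gt0 // mulr_gt0.
exists (Num.sqrt t); first by rewrite sqrtr_gt0.
rewrite (sqr_sqrtr (ltW t0)); split.
  by rewrite mulrC -ler_pdivlMr // ge_min lexx.
by rewrite mulrAC mulrC -ler_pdivlMr ?mulr_gt0 // ge_min lexx orbT.
Qed.

Lemma exists_large_power (e c M : R) : 0 < e -> 0 < c ->
  exists k, M <= e * (1 + c) ^+ k.
Proof.
move=> e0 c0; have M0 : 0 < `|M| + 1 by rewrite ltr_wpDl.
have c1 : 0 < 1 + c by rewrite addr_gt0.
have [||k ck] := @exists_small_power R (1 + c)^-1 (e / (`|M| + 1)).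
- by rewrite invr_ge0 ltW //= invf_lt1 // ltrDl.
- exact: divr_gt0.
exists k; move: ck; rewrite exprVn ltr_pdivlMr // ltr_pdivrMl ?exprn_gt0 //.
by rewrite mulrC => /ltW; apply: le_trans; rewrite ler_wpDr // ler_norm.
Qed.

Lemma exists_near_power (k : nat) (e e' : R) : 0 < e -> e < e' ->
  exists2 x : R, 0 < x & forall t, 0 <= t <= x -> e * (1 + t) ^+ k <= e'.
Proof.
elim: k e' => [|k IH] e' e0 ee.
  by exists 1 => // t _; rewrite expr0 mulr1 ltW.
pose f := (e + e') / 2.
have ef : e < f by rewrite /f; lra.
have f0 : 0 < f by apply: lt_trans ef.
have fe : 0 < e' - f by rewrite /f; lra.
have [x x0 xP] := IH f e0 ef.
exists (Num.min x ((e' - f) / f)); first by rewrite lt_min x0 divr_gt0.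
move=> t /andP[t0]; rewrite le_min => /andP[tx tf].
rewrite exprSr mulrA; apply: (@le_trans _ _ (f * (1 + t))).
  by rewrite ler_wpM2r ?addr_ge0 // xP // t0 tx.
by move: tf; rewrite ler_pdivlMr // mulrDr mulr1; lra.
Qed.

(** The left end of the complementary interval of [K] around [y], cut off at [j]: the supremum of
    [j] and the points of [K] in [[j, y]]. The last hypothesis says that [K] is closed there. *)
Lemma last_before (K : R -> Prop) (j y : R) : j < y -> ~ K y ->
  (forall t, j <= t <= y -> ~ K t ->
    exists2 d : R, 0 < d & forall t', `|t' - t| < d -> ~ K t') ->
  exists a, [/\ j <= a < y, a = j \/ K a & forall t, a < t <= y -> ~ K t].
Proof.
move=> jy Ky Ko; pose E := [set t | j <= t <= y /\ (t = j \/ K t)].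
have Ej : E j by split; [rewrite lexx ltW|left].
have Eub : ubound E y by move=> t [/andP[]].
have Es : has_sup E by split; [exists j|exists y].
pose a := sup E.
have ja : j <= a by apply: ub_le_sup => //; exists y.
have ay : a <= y by apply: ge_sup => //; exists j.
have Ka : a = j \/ K a.
  apply: contrapT => /not_orP[aj nKa].
  have ja' : j < a by rewrite lt_neqAle ja andbT; apply/eqP => E'; apply: aj.
  have [|d d0 dP] := Ko a _ nKa; first by rewrite ja ay.
  have m0 : 0 < Num.min d (a - j) by rewrite lt_min d0 subr_gt0.
  have [t [/andP[jt ty] tK] at_] := sup_adherent m0 Es.
  have ta : t <= a by apply: ub_le_sup; [exists y|split => //; apply/andP].
  have [t1 t2] : a - d < t /\ j < t.
    move: at_; rewrite -/a; clearbody a; clear.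
    by case: (leP d (a - j)) => ? ?; split; lra.
  case: tK => [E'|]; first by rewrite E' ltxx in t2.
  by apply: dP; rewrite ltr_norml; apply/andP; split; lra.
exists a; split => //.
  rewrite ja lt_neqAle ay andbT; apply/eqP => E'.
  by rewrite E' in Ka; case: Ka => // yj; rewrite yj ltxx in jy.
move=> t /andP[at_ ty] Kt; suff : t <= a by rewrite leNgt at_.
apply: ub_le_sup; first by exists y.
split; last by right.
by rewrite ty andbT; apply: le_trans ja (ltW at_).
Qed.

Lemma first_after (K : R -> Prop) (j y : R) : y < j -> ~ K y ->
  (forall t, y <= t <= j -> ~ K t ->
    exists2 d : R, 0 < d & forall t', `|t' - t| < d -> ~ K t') ->
  exists a, [/\ y < a <= j, a = j \/ K a & forall t, y <= t < a -> ~ K t].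
Proof.
move=> yj Ky Ko.
have [|||a [a1 a2 a3]] := @last_before (fun t => K (- t)) (- j) (- y).
- by rewrite ltrN2.
- by rewrite opprK.
- move=> t tj nK; have [|d d0 dP] := Ko (- t) _ nK.
    by case/andP: tj => ? ?; apply/andP; split; lra.
  by exists d => // t' tt; apply: dP; rewrite -normrN opprD !opprK.
exists (- a); split.
- by case/andP: a1 => ? ?; apply/andP; split; lra.
- by case: a2 => [->|]; [left; rewrite opprK|right].
- move=> t /andP[t1 t2]; have := a3 (- t); rewrite opprK; apply.
  by apply/andP; split; lra.
Qed.

(* Baire's theorem for the set of [y] around which the unrestricted upper limits are
   not all bounded by [e]: on a relatively open piece of it the vertical bound holds
   up to a uniform height, and the complementary intervals of that piece
   are handled by [graph_barrier]. *)
Lemma graph_limsup h g (a b e M : R) : continuous h -> 0 < b -> 0 < e ->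
  (forall z, graph_strip h (- a) a b z -> derivable g z 1) ->
  (forall z, graph_strip h (- a) a b z -> cmod (g z) <= M) ->
  (forall y, - a < y < a -> exists2 s0 : R, 0 < s0 &
    forall s, 0 < s < s0 -> cmod (g ((h y - s) +i* y)) <= e) ->
  forall y, - a < y < a -> limsup_le g (graph_strip h (- a) a b) e (h y +i* y).
Proof.
move=> ch b0 e0; set S := graph_strip h (- a) a b => dg gM vert.
(* Asking for the bound on a whole neighbourhood makes [O] open, hence [K] closed in [(-a, a)]. *)
pose O y := exists2 d : R, 0 < d & forall y', `|y' - y| < d -> - a < y' < a ->
  limsup_le g S e (h y' +i* y').
pose K y := - a < y < a /\ ~ O y.
pose E (n : nat) y := forall s, 0 < s < b -> s < n.+1%:R^-1 ->
  cmod (g ((h y - s) +i* y)) <= e.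
have inS y s : - a < y < a -> 0 < s < b -> S ((h y - s) +i* y).
  by move=> ya /andP[s0 sb]; split => //=; apply/andP; split; lra.
suff nK y : ~ K y.
  move=> y ya; have [d d0 dP] : O y by apply: contrapT => nO; apply: (nK y).
  by apply: dP => //; rewrite subrr normr0.
rename y into y_; move=> Ky_.
have nE_open n y : - a < y < a -> ~ E n y ->
    exists2 d : R, 0 < d & forall y', `|y' - y| < d -> ~ E n y'.
  move=> ya /existsNP[s /not_implyP[sb /not_implyP[sn /negP]]]; rewrite -ltNge => ges.
  have cy : (fun y' => cmod (g ((h y' - s) +i* y'))) @ y -->
      cmod (g ((h y - s) +i* y)).
    have c1 : (fun y' : R => (h y' - s) +i* y' : Cc R) @ y --> ((h y - s) +i* y : Cc R).
      by apply: cvg_Complex; [apply: cvgB; [exact: ch|exact: cvg_cst]|exact: cvg_id].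
    have c2 := derivable_cts (dg _ (inS _ _ ya sb)).
    by move=> V /(@cmod_cts R)/c2/c1.
  have /nbhs_ballP[d d0 dP] : \forall y' \near y, e < cmod (g ((h y' - s) +i* y')).
    exact: (cy _ (lt_nbhsr ges)).
  exists d => // y' yy E'; have := dP y'; rewrite /ball /= distrC => /(_ yy).
  by rewrite ltNge E'.
have [n [y0 [eta [Ky0 eta0 En]]]] : exists n y0 eta,
    [/\ K y0, 0 < eta & forall y, K y -> `|y - y0| < eta -> E n y].
  apply: contrapT => H.
  have {}H n y0 eta : K y0 -> 0 < eta -> exists y, [/\ K y, `|y - y0| < eta & ~ E n y].
    move=> k0 t0; apply: contrapT => nH; apply: H; exists n, y0, eta; split => // y Ky yy.
    by apply: contrapT => nE; apply: nH; exists y.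
  (* Intervals as pairs of centre and radius. If no [E n] covers a portion of [K], each contains a
     smaller one, centred in [K], that misses [E n]. *)
  pose Inv (c : R * R) := [/\ K c.1, 0 < c.2, - a < c.1 - c.2 & c.1 + c.2 < a].
  pose step n (c d : R * R) := [/\ Inv d, c.1 - c.2 <= d.1 - d.2, d.1 + d.2 <= c.1 + c.2
    & forall y', `|y' - d.1| <= d.2 -> ~ E n y'].
  have next n c : Inv c -> exists d, step n c d.
    move=> [k1 c0 c1 c2]; have [y [ky yy nE]] := H n _ _ k1 c0.
    have [d d0 dP] := nE_open n y ky.1 nE.
    pose r := Num.min d (c.2 - `|y - c.1|) / 2.
    have r0 : 0 < r by rewrite divr_gt0 // lt_min d0 subr_gt0.
    have [rd rc] : r < d /\ `|y - c.1| + r <= c.2.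
      have m0 : 0 < Num.min d (c.2 - `|y - c.1|) by rewrite lt_min d0 subr_gt0.
      have h1 : Num.min d (c.2 - `|y - c.1|) <= d by rewrite ge_min lexx.
      have h2 : Num.min d (c.2 - `|y - c.1|) <= c.2 - `|y - c.1| by rewrite ge_min lexx orbT.
      by rewrite /r; move: h1 h2 m0; clear; move: (Num.min _ _) => mn *; split; lra.
    have := ler_norm (y - c.1); have := ler_norm (- (y - c.1)); rewrite normrN => n1 n2.
    have [l1 l2] : c.1 - c.2 <= y - r /\ y + r <= c.1 + c.2.
      by clearbody r; clear - rc n1 n2; split; lra.
    exists (y, r); split => //=.
    - by split => //=; [apply: lt_le_trans l1|apply: le_lt_trans c2].
    - by move=> y' yr; apply: dP; apply: le_lt_trans rd.
  have [r [r0 r1 r2]] : exists r, [/\ 0 < r, - a < y_ - r & y_ + r < a].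
    have /andP[u1 u2] := Ky_.1.
    exists (Num.min (y_ + a) (a - y_) / 2).
    have h1 : Num.min (y_ + a) (a - y_) <= y_ + a by rewrite ge_min lexx.
    have h2 : Num.min (y_ + a) (a - y_) <= a - y_ by rewrite ge_min lexx orbT.
    have m0 : 0 < Num.min (y_ + a) (a - y_) by rewrite lt_min; apply/andP; split; lra.
    by move: h1 h2 m0 u1 u2; clear; move: (Num.min _ _) => mn *; split; lra.
  pose nx n c := xget c [set d | step n c d].
  pose fix cn n := if n is n'.+1 then nx n' (cn n') else (y_, r).
  have nxP n c : Inv c -> step n c (nx n c).
    by move=> /(next n)[d dP]; rewrite /nx; case: xgetP => [d' -> //|/(_ d)].
  have cnI n : Inv (cn n).
    by elim: n => [|n /(nxP n)[]//].
  have cnS n : step n (cn n) (cn n.+1) by exact: nxP.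
  have [p pP] : exists p, forall n, (cn n).1 - (cn n).2 <= p <=
      ((cn n).1 - (cn n).2) + 2 * (cn n).2.
    apply: (@nested_intervals _ (fun n => (cn n).1 - (cn n).2) (fun n => 2 * (cn n).2)) => n.
    - by have [] := cnS n.
    - by have [_ _ + _] := cnS n; lra.
    - by have [_ + _ _] := cnI n; lra.
  have pa : - a < p < a.
    have := pP 0%N => /= /andP[p1 p2]; clear - p1 p2 r1 r2.
    by apply/andP; split; lra.
  (* The limit [p] is not claimed to lie in [K]: the vertical bound holds at every point, so [p]
     satisfies some [E n], against the choice of interval [n.+1]. *)
  have [s0 s00 sP] := vert p pa.
  have [n sn] : exists n : nat, n.+1%:R^-1 < s0.
    have [n _ nP] := near_infty_natSinv_lt (PosNum s00).
    by exists n; have := nP n (leqnn n).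
  have [_ _ _ /(_ p)] := cnS n; apply.
    have /andP[] := pP n.+1; rewrite ler_norml; clear => *.
    by apply/andP; split; lra.
  move=> s /andP[s1 _] s2; apply: sP; rewrite s1 /=; exact: lt_trans sn.
(* At this height [E n] covers the whole vertical segment below the graph over a point of [K] near
   [y0]. *)
pose b' := Num.min b n.+1%:R^-1.
have b'0 : 0 < b' by rewrite lt_min b0 invr_gt0 ltr0n.
have [r [r0 rn ra1 ra2 rh]] : exists r, [/\ 0 < r, r <= eta, - a < y0 - r, y0 + r < a &
    forall y, `|y - y0| <= r -> `|h y - h y0| <= b' / 4].
  have b40 : 0 < b' / 4 by rewrite divr_gt0.
  have /nbhs_ballP[d d0 dP] : \forall y \near y0, `|h y0 - h y| < b' / 4.
    by move/cvgrPdist_lt : (ch y0) => /(_ _ b40).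
  have /andP[u1 u2] := Ky0.1.
  pose m := Num.min (Num.min eta d) (Num.min (y0 + a) (a - y0)).
  have m0 : 0 < m by rewrite !lt_min eta0 d0 /=; apply/andP; split; lra.
  have h1 : m <= eta by rewrite !ge_min lexx.
  have h2 : m <= d by rewrite !ge_min lexx orbT.
  have h3 : m <= y0 + a by rewrite !ge_min lexx !orbT.
  have h4 : m <= a - y0 by rewrite !ge_min lexx !orbT.
  have [k1 k2 k3 [k4 k5]] : [/\ 0 < m / 2, m / 2 <= eta, - a < y0 - m / 2 &
      y0 + m / 2 < a /\ m / 2 < d].
    by clearbody m; clear - m0 h1 h2 h3 h4; split; [| | |split]; lra.
  exists (m / 2); split => // y yy; rewrite distrC ltW //; apply: dP.
  by rewrite /ball /= distrC; apply: le_lt_trans yy _.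
apply: Ky0.2; exists (r / 2); first by rewrite divr_gt0.
move=> y1 y1r y1a; have [[d d0 dP]|nO1] := pselect (O y1).
  by apply: dP => //; rewrite subrr normr0.
move=> e' ee.
have y1r' := y1r; move: y1r'; rewrite ltr_norml => /andP[y11 y12].
have r20 : 0 < (r / 2) ^+ 2 by rewrite exprn_gt0 // divr_gt0.
have Lb : 0 < (y0 + r) - (y0 - r) + 2 * b' by clear - r0 b'0; lra.
(* The constants are fixed from [r], [b'], [M], [e] and [e'], before [z] and the complementary
   interval around [Im z] are known. *)
have [c c0 [c1 c2]] := exists_small_square b'0 Lb r20.
have [k kM] := exists_large_power M e0 c0.
have [x x0 xP] := exists_near_power k e0 ee.
have [d d0 dP] := graph_height_cts (h y1 +i* y1) ch b'0.
exists (Num.min d (Num.min (x ^+ 2) (r / 2))).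
  by rewrite !lt_min d0 exprn_gt0 // divr_gt0.
move=> z Sz; rewrite !lt_min => /andP[/dP zh /andP[zx zr]].
rewrite /= subrr subr0 in zh.
have zi : `|complex.Im z - y1| < r / 2.
  by apply: le_lt_trans zr; rewrite -[y1]/(complex.Im (h y1 +i* y1)) -ImB Im_le_cmod.
have zi' := zi; move: zi'; rewrite ltr_norml => /andP[zi1 zi2].
have [/andP[za1 za2] /andP[zb1 zb2]] := Sz.
have zs : 0 < h (complex.Im z) - complex.Re z < b'.
  clear - zh zb2; move: zh; rewrite ltr_norml => /andP[? ?].
  by apply/andP; split; lra.
have b'b : b' <= b by rewrite ge_min lexx.
have b'n : b' <= n.+1%:R^-1 by rewrite ge_min lexx orbT.
have point y (w : Cc R) : complex.Im w = y -> w = (h y - (h y - complex.Re w)) +i* y.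
  by case: w => w1 w2 /= ->; congr (_ +i* _); ring.
have EnS y x' : K y -> `|y - y0| < eta -> h y - b' < x' < h y -> cmod (g (x' +i* y)) <= e.
  move=> Ky yy /andP[x1 x2]; rewrite (point y (x' +i* y)) //=.
  apply: (En y Ky yy); clear - x1 x2 b'b b'n; first by apply/andP; split; lra.
  by apply: lt_le_trans b'n; lra.
have [Kz|nKz] := pselect (K (complex.Im z)).
  apply: le_trans (ltW ee); have -> : z = complex.Re z +i* complex.Im z by case: (z).
  apply: EnS => //; last first.
    by clear - zs; case/andP: zs => ? ?; apply/andP; split; lra.
  apply: lt_le_trans rn; rewrite ltr_norml; clear - zi1 zi2 y11 y12.
  by apply/andP; split; lra.
have Kopen t : y0 - r <= t <= y0 + r -> ~ K t ->
    exists2 d : R, 0 < d & forall t', `|t' - t| < d -> ~ K t'.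
  move=> /andP[t1 t2] nKt.
  have ta : - a < t < a by clear - t1 t2 ra1 ra2; apply/andP; split; lra.
  have [u u0 uP] : O t by apply: contrapT => nO; apply: nKt.
  exists (u / 2); first by rewrite divr_gt0.
  move=> t' tt [t'a]; apply; exists (u / 2); first by rewrite divr_gt0.
  move=> t'' tt'; apply: uP; rewrite -(subrKA t') (splitr u).
  by apply: le_lt_trans (ler_normD _ _) _; exact: ltrD.
have [|t tt|a1 [/andP[a11 a12] a1K a1n]] := @last_before K (y0 - r) (complex.Im z) _ nKz.
- by clear - zi1 y11; lra.
- apply: Kopen; case/andP: tt => t1 t2; clear - t1 t2 zi1 zi2 y11 y12.
  by apply/andP; split; lra.
have [|t tt|a2 [/andP[a21 a22] a2K a2n]] := @first_after K (y0 + r) (complex.Im z) _ nKz.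
- by clear - zi2 y12; lra.
- apply: Kopen; case/andP: tt => t1 t2; clear - t1 t2 zi1 zi2 y11 y12.
  by apply/andP; split; lra.
have SS w : graph_strip h a1 a2 b' w -> S w.
  clear - ra1 ra2 a11 a22 b'b; move=> [/andP[? ?] /andP[? ?]].
  by split; apply/andP; split; lra.
have bar := @graph_barrier h g (y0 - r) (y0 + r) a1 a2 b' (r / 2) M e c y1 k ch b'0.
have Sz' : graph_strip h a1 a2 b' z.
  clear - zs a12 a21; case/andP: zs => ? ?.
  by split; apply/andP; split; lra.
apply: le_trans (bar _ e0 c0 c1 c2 kM a11 a22 _ _ _ _ _ _ z Sz') _.
- by rewrite divr_gt0.
- by clear - y11 y12 r0; apply/andP; split; lra.
- move=> y /andP[yr1 yr2].
  have := rh y; have := rh y1.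
  have -> : `|y - y0| <= r.
    by clear - yr1 yr2; rewrite ler_norml; apply/andP; split; lra.
  have -> : `|y1 - y0| <= r.
    by clear - y11 y12 r0; rewrite ler_norml; apply/andP; split; lra.
  move=> /(_ isT) + /(_ isT); have := ler_distD (h y0) (h y) (h y1).
  by clear; rewrite (distrC (h y0)); lra.
- by move=> w /SS; exact: dg.
- by move=> w /SS; exact: gM.
- move=> y /andP[y1' y2'] e'' ee''.
  have nKy : ~ K y.
    have [yz|yz] := leP y (complex.Im z).
      by apply: a1n; apply/andP; split.
    by apply: a2n; apply/andP; split => //; exact: ltW.
  have ya : - a < y < a.
    by clear - y1' y2' ra1 ra2 a11 a22; apply/andP; split; lra.
  have [u u0 uP] : O y by apply: contrapT => nO; apply: nKy.
  have [|d' d'0 d'P] := uP y _ ya _ ee''; first by rewrite subrr normr0.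
  by exists d' => // w /SS; exact: d'P.
- move=> y ya12.
  (* [E n] is only known for [|y - y0| < eta], and [r] may equal [eta]. An endpoint that escapes it
     is at distance at least [r / 2] from the centre [y1], where the barrier damps. *)
  have sideK : K y -> `|y - y0| <= r -> `|y - y0| < eta \/ r / 2 <= `|y - y1|.
    move=> _ yr; have := ler_distD y1 y y0; have [i|i] := leP (r / 2) `|y - y1|.
      by right.
    by move=> H; left; clear - rn y1r i H; lra.
  have sideP : K y -> `|y - y0| < eta ->
      forall x', h y - b' < x' < h y -> limsup_le g (graph_strip h a1 a2 b') e (x' +i* y).
    move=> Ky yy x' xx e'' ee''.
    have le1 := EnS y x' Ky yy xx.
    have Sx : S (x' +i* y).
      by split => /=; [exact: Ky.1|clear - xx b'b; case/andP: xx => ? ?; apply/andP; split; lra].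
    have cg : (fun w => cmod (g w)) @ (x' +i* y : Cc R) --> cmod (g (x' +i* y)).
      by apply: continuous_comp; [exact: derivable_cts (dg _ Sx)|exact: cmod_cts].
    have /near_cmodP[d' d'0 d'P] : \forall w \near (x' +i* y : Cc R), cmod (g w) < e''.
      exact: (cg _ (lt_nbhsl (le_lt_trans le1 ee''))).
    by exists d' => // w _ /d'P/ltW.
  have far (t : R) : `|t - y0| = r -> r / 2 <= `|t - y1|.
    move=> tr; have := ler_distD y1 t y0; rewrite tr; clear - y1r; lra.
  have yr : `|y - y0| <= r.
    case: ya12 => ->; rewrite ler_norml; clear - a11 a12 a21 a22 zi1 zi2 y11 y12.
      by apply/andP; split; lra.
    by apply/andP; split; lra.
  have yK : y = y0 - r \/ y = y0 + r \/ K y.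
    by case: ya12 => ->; [case: a1K|case: a2K]; auto.
  case: yK => [->|[->|Ky]].
  + by left; apply: far; rewrite addrAC subrr add0r normrN gtr0_norm.
  + by left; apply: far; rewrite addrAC subrr add0r gtr0_norm.
  + by case: (sideK Ky yr) => [yy|]; [right; exact: sideP|left].
apply: xP; rewrite sqrtr_ge0 /=.
rewrite -(@ler_pXn2r _ 2) ?nnegrE ?sqrtr_ge0 ?(ltW x0) // sqr_sqrtr ?cmod_ge0 //.
by rewrite cmod_distC ltW.
Qed.

(** [d] is chosen before [h] and [g], hence is common to all slices. [graph_limsup] supplies the
    bound on the graph, without a rate; the barrier on the full strip, centred straight above the
    point, then costs [(1 + sqrt s)^k <= 2]. For [|y| <= a / 2] both sides are at distance at least
    [a / 2], and [|h| <= b / 4] bounds the oscillation. *)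
Lemma graph_uniform (a b M e : R) : 0 < a -> 0 < b -> 0 < e ->
  exists2 d : R, 0 < d & forall h g, continuous h ->
    (forall y, - a <= y <= a -> `|h y| <= b / 4) ->
    (forall z, graph_strip h (- a) a b z -> derivable g z 1) ->
    (forall z, graph_strip h (- a) a b z -> cmod (g z) <= M) ->
    (forall y, - a < y < a -> exists2 s0 : R, 0 < s0 &
      forall s, 0 < s < s0 -> cmod (g ((h y - s) +i* y)) <= e) ->
    forall y s, `|y| <= a / 2 -> 0 < s < d -> cmod (g ((h y - s) +i* y)) <= 2 * e.
Proof.
move=> a0 b0 e0.
have a20 : 0 < (a / 2) ^+ 2 by rewrite exprn_gt0 // divr_gt0.
have Lb : 0 < a - (- a) + 2 * b by lra.
have [c c0 [c1 c2]] := exists_small_square b0 Lb a20.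
have [k kM] := exists_large_power M e0 c0.
have e2 : e < 2 * e by lra.
have [x x0 xP] := exists_near_power k e0 e2.
exists (Num.min b (x ^+ 2)); first by rewrite lt_min b0 exprn_gt0.
move=> h g ch hb dg gM vert y s ya /andP[s0]; rewrite lt_min => /andP[sb sx].
have lim := graph_limsup ch b0 e0 dg gM vert.
move: (ya); rewrite ler_norml => /andP[ya1 ya2].
have Sz : graph_strip h (- a) a b ((h y - s) +i* y).
  by clear - sb s0 ya1 ya2 a0; split => /=; apply/andP; split; lra.
have ha y' : - a <= y' <= a -> `|h y' - h y| <= b / 2.
  move=> y'a; have := ler_normB (h y') (h y).
  have := hb _ y'a; have := hb y; have -> : - a <= y <= a.
    by clear - ya1 ya2 a0; apply/andP; split; lra.
  by move=> /(_ isT); clear; lra.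
have a2' : 0 < a / 2 by rewrite divr_gt0.
have := @graph_barrier h g (- a) a (- a) a b (a / 2) M e c y k ch b0 a2' e0 c0 c1 c2 kM
  (lexx _) (lexx _) _ ha dg gM lim _ _ Sz.
rewrite (_ : h y +i* y - (h y - s) +i* y = s%:C); last first.
  by simpc; congr (_ +i* _); ring.
move=> H; apply: le_trans (H _ _) _.
- by clear - ya1 ya2 a0; apply/andP; split; lra.
- move=> y' y'a; left; rewrite ler_normr; apply/orP; clear - y'a ya1 ya2.
  by case: y'a => ->; [right|left]; lra.
have -> : cmod s%:C = s by exact: etrans (cmod_real s) (gtr0_norm s0).
apply: xP; rewrite sqrtr_ge0 /=.
by rewrite -(@ler_pXn2r _ 2) ?nnegrE ?sqrtr_ge0 ?(ltW x0) // sqr_sqrtr ltW.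
Qed.

End Barrier.


(** * The boundary near the point (1, 0) *)

Section Interpolation.
Context {R : realType}.

Lemma sin_natpi n : sin (n%:R * pi : R) = 0.
Proof.
elim: n => [|n IH]; first by rewrite mul0r sin0.
by rewrite -natr1 mulrDl mul1r sinDpi IH oppr0.
Qed.

Lemma sin_natpi_half n : sin ((n%:R + 2^-1) * pi : R) ^+ 2 = 1.
Proof.
elim: n => [|n IH].
  by rewrite add0r mulrC -[_ / _]/(pi / 2) sin_pihalf expr1n.
by rewrite -natr1 addrAC mulrDl mul1r sinDpi sqrrN IH.
Qed.

Definition interpolation_time (n : nat) : R := 1 - (n%:R + 2^-1)^-1.

(* With [s = 1 / (1 - t)] take [sin (pi s)^2 u_(floor s)]: the factor vanishes where
   the index jumps, and equals 1 at the half-integers. *)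
Lemma exists_interpolation (u : nat -> R) : (forall n, `|u n| <= n.+1%:R^-1) ->
  exists gam : R -> R, [/\ continuous gam, gam 1 = 0,
    (forall B : R, (forall n, `|u n| <= B) -> forall t, `|gam t| <= B) &
    forall n, gam (interpolation_time n) = u n].
Proof.
move=> un.
pose s t : R := (1 - t)^-1.
pose gam t : R := if t < 1 then sin (s t * pi) ^+ 2 * u (Num.truncn (s t)) else 0.
have sin2 (x : R) : 0 <= sin x ^+ 2 <= 1.
  rewrite sqr_ge0 /= -[1](expr1n _ 2) -[X in X <= _]real_normK ?num_real //.
  by rewrite lerXn2r ?nnegrE // sin_max.
have gle B : (forall n, `|u n| <= B) -> forall t, `|gam t| <= B.
  move=> uB t; rewrite /gam; case: ifP => _; last first.
    by rewrite normr0; apply: le_trans (uB 0%N).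
  have /andP[s0 s1] := sin2 (s t * pi); rewrite normrM ger0_norm //.
  by apply: le_trans (uB (Num.truncn (s t))); rewrite ler_piMl.
(* With [n] the integer part of [s], [|u n| <= 1 / (n + 1) < 1 / s = 1 - t]; this gives continuity
   at 1. *)
have g1 t : `|gam t| <= `|1 - t|.
  rewrite /gam; case: ltP => t1; last by rewrite normr0.
  have st0 : 0 < s t by rewrite invr_gt0 subr_gt0.
  have /andP[s0 s1] := sin2 (s t * pi); rewrite normrM ger0_norm //.
  apply: (@le_trans _ _ `|u (Num.truncn (s t))|); first by rewrite ler_piMl.
  apply: le_trans (un _) _; rewrite [leRHS]gtr0_norm ?subr_gt0 //.
  rewrite -[leRHS]invrK lef_pV2 ?posrE ?ltr0n // ltW //.
  by have := truncn_itv (ltW st0) => /andP[].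
exists gam; split => //.
- move=> t; have [t1|t1|->] := ltgtP t 1; last first.
  + apply/(@cvgrPdist_lt _ _ _ (nbhs (1 : R)) (nbhs_filter _)) => e e0.
    apply: filterS (nbhsx_ballx (1 : R) e e0) => x; rewrite /ball /=.
    by rewrite {1}/gam ltxx sub0r normrN; apply: le_lt_trans (g1 x).
  + have : gam t = 0 by rewrite /gam ltNge (ltW t1).
    rewrite /continuous_at => ->; apply: cvg_near_cst.
    by apply: filterS (lt_nbhsr t1) => x x1; rewrite /gam ltNge (ltW x1).
  have t10 : 1 - t != 0 by rewrite gt_eqF // subr_gt0.
  have cs : s x @[x --> t] --> s t.
    apply: cvgV => //; apply: cvgB; [exact: cvg_cst|exact: cvg_id].
  have cp : sin (s x * pi) ^+ 2 @[x --> t] --> sin (s t * pi) ^+ 2.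
    have c1 : s x * pi @[x --> t] --> s t * pi by apply: cvgM => //; exact: cvg_cst.
    have c2 : sin (s x * pi) @[x --> t] --> sin (s t * pi).
      by move=> V /(@continuous_sin R)/c1.
    exact: (cvgM c2 c2).
  have st0 : 0 < s t by rewrite invr_gt0 subr_gt0.
  have /andP[n1 n2] := truncn_itv (ltW st0); set n := Num.truncn (s t) in n1 n2.
  have [sn|sn] := eqVneq n%:R (s t).
    have gt0 : gam t = 0 by rewrite /gam t1 -sn sin_natpi expr0n mul0r.
    apply/(@cvgrPdist_lt _ _ _ (nbhs t) (nbhs_filter _)) => e e0; rewrite gt0.
    move/cvgrPdist_lt : cp => /(_ _ e0); rewrite -sn sin_natpi expr0n /=.
    apply: filterS => x; rewrite !sub0r !normrN => xe; apply: le_lt_trans xe.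
    rewrite /gam; case: ifP => _; last by rewrite normr0.
    rewrite normrM ler_piMr //; apply: le_trans (un _) _.
    by rewrite invf_le1 ?ltr0n // ler1n.
  have sn' : n%:R < s t by rewrite lt_neqAle sn.
  rewrite /continuous_at {2}/gam t1.
  have near_n : \forall x \near t, gam x = sin (s x * pi) ^+ 2 * u n.
    have e1 := cs _ (lt_nbhsr sn'); have e2 := cs _ (lt_nbhsl n2).
    have e3 := lt_nbhsl t1.
    near=> x; have x1 : x < 1 by near: x.
    rewrite /gam x1 (_ : Num.truncn (s x) = n) //; apply: truncn_def.
    by apply/andP; split; [apply: ltW; near: x|near: x].
  apply: cvg_trans (cvgM cp (cvg_cst (u n))).
  by apply: near_eq_cvg; apply: filterS near_n => x ->.
- by rewrite /gam ltxx.
- move=> n; have n0 : 0 < n%:R + 2^-1 :> R by rewrite ltr_wpDl // invr_gt0.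
  have sE : s (interpolation_time n) = n%:R + 2^-1.
    by rewrite /s /interpolation_time opprB addrC subrK invrK.
  rewrite /gam sE sin_natpi_half mul1r.
  have -> : interpolation_time n < 1.
    by rewrite /interpolation_time ltrBlDr ltrDl invr_gt0.
  congr u; apply: truncn_def; apply/andP; split; first by rewrite lerDl invr_ge0.
  by rewrite -(natr1 n) ltrD2l invf_lt1 // ltr1n.
Unshelve. all: by end_near. Qed.

End Interpolation.

(** * The defining function along real lines *)

Section DefiningFunction.
Context {R : realType}.
Implicit Types (rho : C2 R -> R) (z p q v : C2 R) (x y d : R) (w : Cc R).

Lemma near_C2P p (S : set (C2 R)) : (\forall z \near p, S z) <->
  exists2 d : R, 0 < d & forall z, cmod (z.1 - p.1) < d -> cmod (z.2 - p.2) < d -> S z.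
Proof.
split.
  case=> -[V W] [/= /near_cmodP[d1 d10 V1] /near_cmodP[d2 d20 W1]] H.
  exists (Num.min d1 d2); first by rewrite lt_min d10.
  move=> z; rewrite !lt_min => /andP[z1 _] /andP[_ z2].
  by apply: H; split; [exact: V1|exact: W1].
case=> d d0 H; exists ([set a | cmod (a - p.1) < d], [set b | cmod (b - p.2) < d]).
  by split; apply/near_cmodP; exists d.
by move=> z [z1 z2]; exact: H.
Qed.

Lemma defining_cts rho : smooth_on setT (rhoC rho) -> continuous rho.
Proof.
move=> sm z; have [c _] := sm [::] z I.
by apply: (@continuous_comp _ _ _ (rhoC rho) (@complex.Re R)); [exact: c|exact: cts_Re].
Qed.

Definition ddir rho v z : R := derive1 (fun t : R => rho (z + t%:C *: v)) 0.

Lemma ddir_cts rho v : smooth_on setT (rhoC rho) -> continuous (ddir rho v).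
Proof.
move=> sm z; have [c _] := sm [:: v] z I.
by apply: (@continuous_comp _ _ _ (rpd v (rhoC rho)) (@complex.Re R)); [exact: c|exact: cts_Re].
Qed.

Lemma line_is_derive rho v z (t : R) : smooth_on setT (rhoC rho) ->
  is_derive t 1 (fun t : R => rho (z + t%:C *: v)) (ddir rho v (z + t%:C *: v)).
Proof.
move=> sm; have [_ /(_ v)[dR _]] := sm [::] (z + t%:C *: v) I.
have d0 : is_derive (shift (- t) t : R) 1
    (fun s : R => rho (z + t%:C *: v + s%:C *: v)) (ddir rho v (z + t%:C *: v)).
  by rewrite /= subrr /ddir derive1E; exact: derivableP.
have d1 := is_derive1_comp d0 (is_derive_shift t 1 (- t)).
apply: is_derive_eqfun d1; last by rewrite mulr1.
move=> s /=; congr rho; rewrite -addrA -scalerDl -rmorphD /=.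
by congr (_ + _%:C *: _); ring.
Qed.

Lemma line_MVT rho v z (a b : R) : smooth_on setT (rhoC rho) -> a <= b ->
  exists2 c, a <= c <= b &
    rho (z + b%:C *: v) - rho (z + a%:C *: v) = ddir rho v (z + c%:C *: v) * (b - a).
Proof.
move=> sm ab.
have [||c] := @MVT_segment R (fun t : R => rho (z + t%:C *: v))
  (fun t => ddir rho v (z + t%:C *: v)) a b ab.
- by move=> t _; exact: line_is_derive.
- apply: continuous_subspaceT => t; apply: differentiable_continuous.
  by apply/derivable1_diffP; have [] := line_is_derive v z t sm.
- by rewrite in_itv /= => cab E; exists c.
Qed.

Lemma line_MVT_unordered rho v z (a b : R) : smooth_on setT (rhoC rho) ->
  exists2 c, a <= c <= b \/ b <= c <= a &
    rho (z + b%:C *: v) - rho (z + a%:C *: v) = ddir rho v (z + c%:C *: v) * (b - a).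
Proof.
move=> sm; have [ab|/ltW ba] := leP a b.
  by have [c cab E] := line_MVT v z sm ab; exists c => //; left.
have [c cab E] := line_MVT v z sm ba; exists c; first by right.
by rewrite -opprB E; ring.
Qed.

Lemma bdry_zero rho p : continuous rho -> bdry rho p -> rho p = 0.
Proof.
move=> cr [clp nip]; apply/eqP; rewrite eq_le; apply/andP; split.
  rewrite leNgt; apply/negP => p0.
  have [q [qD q0]] := clp [set z | 0 < rho z] (cr p _ (lt_nbhsr p0)).
  by move: qD; rewrite /Dom /= ltNge (ltW q0).
rewrite leNgt; apply/negP => p0; apply: nip.
exact: (cr p _ (lt_nbhsl p0)).
Qed.

Lemma bdry_of_limit rho p (q : R -> C2 R) : rho p = 0 ->
  (forall V, nbhs p V -> exists s, V (q s) /\ rho (q s) < 0) -> bdry rho p.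
Proof.
move=> p0 qP; split.
  by move=> V /qP[s [Vs qs]]; exists (q s).
by move=> /interior_subset; rewrite /Dom /= p0 ltxx.
Qed.

(** A cube in the four real coordinates around [(1, 0)]: changing one coordinate at a time between
    two of its points does not leave it. *)
Definition box d : set (C2 R) := [set z | [/\ `|complex.Re z.1 - 1| < d,
  `|complex.Im z.1| < d, `|complex.Re z.2| < d & `|complex.Im z.2| < d]].

Lemma box_sub (e d : R) z : e <= d -> box e z -> box d z.
Proof. by move=> ed [? ? ? ?]; split; apply: lt_le_trans ed. Qed.

Lemma near_box (S : set (C2 R)) : (\forall z \near ((1, 0) : C2 R), S z) ->
  exists2 d : R, 0 < d & forall z, box d z -> S z.
Proof.
move=> /near_C2P[d d0 H]; exists (d / 2); first by rewrite divr_gt0.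
move=> z [z1 z2 z3 z4]; apply: H => /=; apply: le_lt_trans (cmod_le_ReIm _) _.
  by rewrite ReB ImB /= subr0; lra.
by rewrite ReB ImB /= !subr0; lra.
Qed.

Lemma box_near d : 0 < d -> \forall z \near ((1, 0) : C2 R), box d z.
Proof.
move=> d0; apply/near_C2P; exists d => // z /= z1; rewrite subr0 => z2.
have := Re_le_cmod (z.1 - 1); have := Im_le_cmod (z.1 - 1).
have := Re_le_cmod z.2; have := Im_le_cmod z.2.
by rewrite ReB ImB /= subr0 => ? ? ? ?; split; lra.
Qed.

Lemma cmod1_le_dist z q : cmod (z.1 - q.1) <= eucl_dist z q.
Proof.
rewrite -(@ler_pXn2r _ 2) ?nnegrE ?cmod_ge0 ?sqrtr_ge0 //.
by rewrite sqr_sqrtr ?addr_ge0 ?sqr_ge0 // lerDl sqr_ge0.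
Qed.

Lemma cmod2_le_dist z q : cmod (z.2 - q.2) <= eucl_dist z q.
Proof.
rewrite -(@ler_pXn2r _ 2) ?nnegrE ?cmod_ge0 ?sqrtr_ge0 //.
by rewrite sqr_sqrtr ?addr_ge0 ?sqr_ge0 // lerDr sqr_ge0.
Qed.

Definition coords (x1 y1 x2 y2 : R) : C2 R := (x1 +i* y1, x2 +i* y2).

Lemma coordsE z :
  z = coords (complex.Re z.1) (complex.Im z.1) (complex.Re z.2) (complex.Im z.2).
Proof. by case: z => -[a b] [c e]. Qed.

(** The [coords_move] lemmas isolate one real coordinate as the parameter of a line, the form
    required by the mean value theorem. *)
Lemma coords_move_x1 (x1 y1 x2 y2 : R) :
  coords x1 y1 x2 y2 = coords 0 y1 x2 y2 + x1%:C *: ex1 R.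
Proof.
rewrite /coords; congr pair => /=; rewrite -[_ *: _]/(_ * _) /=.
  by simpc.
by rewrite mulr0 addr0.
Qed.

Lemma coords_move_y1 (x1 y1 x2 y2 : R) :
  coords x1 y1 x2 y2 = coords x1 0 x2 y2 + y1%:C *: ('i *: ex1 R).
Proof.
rewrite /coords; congr pair => /=; rewrite -![_ *: _]/(_ * _) /=.
  by simpc.
by rewrite !mulr0 addr0.
Qed.

Lemma coords_move_x2 (x1 y1 x2 y2 : R) :
  coords x1 y1 x2 y2 = coords x1 y1 0 y2 + x2%:C *: ex2 R.
Proof.
rewrite /coords; congr pair => /=; rewrite -[_ *: _]/(_ * _) /=.
  by rewrite mulr0 addr0.
by simpc.
Qed.

Lemma coords_move_y2 (x1 y1 x2 y2 : R) :
  coords x1 y1 x2 y2 = coords x1 y1 x2 0 + y2%:C *: ('i *: ex2 R).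
Proof.
rewrite /coords; congr pair => /=; rewrite -![_ *: _]/(_ * _) /=.
  by rewrite !mulr0 addr0.
by simpc.
Qed.

(** The gradient at [(1, 0)] may point either way along the real axis; [sg] records its sign. The
    bound [d <= 1/2] keeps the box away from the origin, the default value of [bproj]. *)
Definition bounded_frame rho (sg d c K : R) : Prop :=
  smooth_on setT (rhoC rho) /\
  [/\ sg = 1 \/ sg = -1, 0 < d <= 2^-1, 0 < c, 0 < K &
   forall z, box d z ->
     [/\ c <= sg * ddir rho (ex1 R) z,
      `|ddir rho (ex1 R) z| <= K, `|ddir rho ('i *: ex1 R) z| <= K,
      `|ddir rho (ex2 R) z| <= K & `|ddir rho ('i *: ex2 R) z| <= K]].

Lemma exists_bounded_frame rho : smooth_on setT (rhoC rho) ->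
  (exists2 c : R, c != 0 & grad rho (1, 0) = (c%:C, 0)) ->
  exists sg d c K, bounded_frame rho sg d c K.
Proof.
move=> sm [c c0 gE].
have dE : ddir rho (ex1 R) (1, 0) = c.
  have := congr1 (fun u : C2 R => complex.Re u.1) gE => /=.
  by rewrite mul0r mul1r (derive1E (fun=> 0)) derive_cst subr0 addr0.
pose sg : R := if 0 < c then 1 else -1.
have sgP : sg = 1 \/ sg = -1 by rewrite /sg; case: ifP; [left|right].
have sc : 0 < sg * c.
  rewrite /sg; have [cp|] := ltP 0 c; first by rewrite mul1r.
  by rewrite le_eqVlt (negbTE c0) /= mulN1r oppr_gt0.
pose S v := `|ddir rho v (1, 0)| + 1.
have near_S v : \forall z \near ((1, 0) : C2 R), `|ddir rho v z| < S v.
  have cn : (fun z => `|ddir rho v z|) @ ((1, 0) : C2 R) --> `|ddir rho v (1, 0)|.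
    by apply: cvg_norm; exact: ddir_cts.
  by apply: (cn _ (lt_nbhsl _)); rewrite ltrDl.
have near_c : \forall z \near ((1, 0) : C2 R), sg * c / 2 < sg * ddir rho (ex1 R) z.
  have cn : (fun z => sg * ddir rho (ex1 R) z) @ ((1, 0) : C2 R) --> sg * c.
    by rewrite -dE; apply: cvgM; [exact: cvg_cst|exact: ddir_cts].
  by apply: (cn _ (lt_nbhsr _)); rewrite ltr_pdivrMr // ltr_pMr // ltr1n.
have [d d0 dP] : exists2 d : R, 0 < d & forall z, box d z ->
    [/\ sg * c / 2 < sg * ddir rho (ex1 R) z, `|ddir rho (ex1 R) z| < S (ex1 R),
     `|ddir rho ('i *: ex1 R) z| < S ('i *: ex1 R), `|ddir rho (ex2 R) z| < S (ex2 R) &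
     `|ddir rho ('i *: ex2 R) z| < S ('i *: ex2 R)].
  apply: near_box.
  apply: filterS (filterI near_c (filterI (near_S (ex1 R)) (filterI (near_S ('i *: ex1 R))
    (filterI (near_S (ex2 R)) (near_S ('i *: ex2 R)))))) => z.
  by move=> [? [? [? [? ?]]]].
have S0 v : 0 < S v by rewrite /S ltr_wpDl.
clear near_S; clearbody S.
exists sg, (Num.min d (2^-1)), (sg * c / 2),
  (S (ex1 R) + S ('i *: ex1 R) + S (ex2 R) + S ('i *: ex2 R)).
split=> //; split => //.
- by rewrite lt_min d0 invr_gt0 ltr0n /= ge_min lexx orbT.
- by rewrite divr_gt0.
- exact: (addr_gt0 (addr_gt0 (addr_gt0 (S0 _) (S0 _)) (S0 _)) (S0 _)).
move=> z [z1 z2 z3 z4]; have [|h1 h2 h3 h4 h5] := dP z.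
  by move: z1 z2 z3 z4; rewrite !lt_min => /andP[? _] /andP[? _] /andP[? _] /andP[? _].
have := S0 (ex1 R); have := S0 ('i *: ex1 R); have := S0 (ex2 R).
have := S0 ('i *: ex2 R).
move: h1 h2 h3 h4 h5; clear.
move: (ddir _ _ _) (ddir _ _ _) (ddir _ _ _) (ddir _ _ _) (S _) (S _) (S _) (S _) => *.
by split; [exact: ltW| | | |]; lra.
Qed.

End DefiningFunction.

Lemma strip_norm {R : realType} (h s d : R) :
  `|h| < d / 2 / 4 -> h - d / 2 < s < h -> `|s| < d.
Proof.
rewrite !ltr_norml => /andP[h1 h2] /andP[s1 s2]; apply/andP; split; lra.
Qed.

(** * Monotonicity of the defining function and nontangential approach along normals *)

Section LocalGraph.
Context {R : realType} (rho : C2 R -> R) (sg d c K : R).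
Context (fr : bounded_frame rho sg d c K).
Implicit Types (z p q : C2 R) (x y s : R) (w : Cc R).

Let sm : smooth_on setT (rhoC rho) := fr.1.

Let sgP : sg = 1 \/ sg = -1.
Proof. by case: fr => _ []. Qed.

Let d0 : 0 < d.
Proof. by case: fr => _ [_ /andP[]]. Qed.

Let d2 : d <= 2^-1.
Proof. by case: fr => _ [_ /andP[]]. Qed.

Let c0 : 0 < c.
Proof. by case: fr => _ []. Qed.

Let K0 : 0 < K.
Proof. by case: fr => _ []. Qed.

Let frP z : box d z ->
  [/\ c <= sg * ddir rho (ex1 R) z,
    `|ddir rho (ex1 R) z| <= K, `|ddir rho ('i *: ex1 R) z| <= K,
    `|ddir rho (ex2 R) z| <= K & `|ddir rho ('i *: ex2 R) z| <= K].
Proof. by case: fr => _ [_ _ _ _]; apply. Qed.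

Let cr : continuous rho.
Proof. exact: defining_cts. Qed.

Lemma sign_norm x : `|sg * x| = `|x|.
Proof. by case: sgP => ->; rewrite ?mul1r // mulN1r normrN. Qed.

Lemma sign_sqr : sg * sg = 1.
Proof. by case: sgP => ->; rewrite ?mul1r // mulN1r opprK. Qed.

(* The coordinate [x + i y = sg (z1 - 1)] makes [rho] increase with [x]. *)
Definition bpt x y w : C2 R := ((1 + sg * x) +i* (sg * y), w).

Lemma box_bpt e x y w : box e (bpt x y w) <->
  [/\ `|x| < e, `|y| < e, `|complex.Re w| < e & `|complex.Im w| < e].
Proof. by rewrite /box /= [1 + _]addrC addrK !sign_norm. Qed.

Lemma bptE z : z = bpt (sg * (complex.Re z.1 - 1)) (sg * complex.Im z.1) z.2.
Proof.
case: z => -[a b] w; rewrite /bpt /= !mulrA sign_sqr !mul1r.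
by congr ((_ +i* _), _); ring.
Qed.

Lemma rho_slope x x' y w : x <= x' -> box d (bpt x y w) -> box d (bpt x' y w) ->
  c * (x' - x) <= rho (bpt x' y w) - rho (bpt x y w).
Proof.
move=> xx /box_bpt[b1 b2 b3 b4] /box_bpt[b5 _ _ _].
have E u : bpt u y w = ((1 +i* (sg * y), w) : C2 R) + (sg * u)%:C *: ex1 R.
  rewrite /bpt /ex1; congr pair => /=; last by rewrite scaler0 addr0.
  by rewrite -[_ *: _]/(_ * _) mulr1; simpc.
rewrite !E; have [t tP ->] := line_MVT_unordered (ex1 R)
  ((1 +i* (sg * y), w) : C2 R) (sg * x) (sg * x') sm.
have tE : t = sg * (sg * t) by rewrite mulrA sign_sqr mul1r.
have sb : x <= sg * t <= x'.
  by case: sgP tP => ->; rewrite ?mul1r ?mulN1r => -[]/andP[h1 h2]; apply/andP; split; lra.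
have bt : box d (bpt (sg * t) y w).
  apply/box_bpt; split => //; move: b1 b5 sb; rewrite !ltr_norml.
  by move=> /andP[? ?] /andP[? ?] /andP[? ?]; apply/andP; split; lra.
have [+ _ _ _ _] := frP bt; rewrite E -tE => sl.
rewrite -mulrBr mulrA [_ * sg]mulrC; apply: ler_wpM2r => //.
by rewrite subr_ge0.
Qed.

Lemma rho_strict x x' y w : x < x' -> box d (bpt x y w) -> box d (bpt x' y w) ->
  rho (bpt x y w) < rho (bpt x' y w).
Proof.
move=> xx b1 b2; rewrite -subr_gt0; apply: lt_le_trans (rho_slope (ltW xx) b1 b2).
by rewrite mulr_gt0 // subr_gt0.
Qed.

(** The real coordinates are changed one after the other; each of the four steps costs [K] times the
    distance. *)
Lemma rho_lipschitz z q : box d z -> box d q ->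
  `|rho z - rho q| <= 4 * K * eucl_dist z q.
Proof.
rewrite (coordsE z) (coordsE q).
set x1 := complex.Re z.1; set y1 := complex.Im z.1.
set x2 := complex.Re z.2; set y2 := complex.Im z.2.
set u1 := complex.Re q.1; set v1 := complex.Im q.1.
set u2 := complex.Re q.2; set v2 := complex.Im q.2.
move=> [/= zx1 zy1 zx2 zy2] [/= qx1 qy1 qx2 qy2].
set D := eucl_dist _ _.
have n1 : cmod ((x1 +i* y1) - (u1 +i* v1)) <= D.
  exact: (cmod1_le_dist (coords x1 y1 x2 y2) (coords u1 v1 u2 v2)).
have n2 : cmod ((x2 +i* y2) - (u2 +i* v2)) <= D.
  exact: (cmod2_le_dist (coords x1 y1 x2 y2) (coords u1 v1 u2 v2)).
have step v z0 (a b : R) : `|b - a| <= D ->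
    (forall t, a <= t <= b \/ b <= t <= a -> `|ddir rho v (z0 + t%:C *: v)| <= K) ->
    `|rho (z0 + b%:C *: v) - rho (z0 + a%:C *: v)| <= K * D.
  move=> ab H; have [t tP ->] := line_MVT_unordered v z0 a b sm.
  by rewrite normrM ler_pM // H.
have mid e (a b t : R) : `|a - e| < d -> `|b - e| < d -> a <= t <= b \/ b <= t <= a -> `|t - e| < d.
  rewrite !ltr_norml => /andP[h1 h2] /andP[h3 h4] [] /andP[h5 h6]; apply/andP; split; lra.
have mid0 (a b t : R) : `|a| < d -> `|b| < d -> a <= t <= b \/ b <= t <= a -> `|t| < d.
  by have := @mid 0 a b t; rewrite !subr0.
have D1 : `|x1 - u1| <= D /\ `|y1 - v1| <= D.
  by split; apply: le_trans n1; [have := Re_le_cmod|have := Im_le_cmod];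
    move=> /(_ _ ((x1 +i* y1) - (u1 +i* v1))).
have D2 : `|x2 - u2| <= D /\ `|y2 - v2| <= D.
  by split; apply: le_trans n2; [have := Re_le_cmod|have := Im_le_cmod];
    move=> /(_ _ ((x2 +i* y2) - (u2 +i* v2))).
have s1 : `|rho (coords x1 y1 x2 y2) - rho (coords u1 y1 x2 y2)| <= K * D.
  rewrite (coords_move_x1 x1) (coords_move_x1 u1); apply: step; first exact: D1.1.
  move=> t tt; rewrite -coords_move_x1.
  have [|_ ? _ _ _ //] := @frP (coords t y1 x2 y2).
  by split => //=; exact: mid tt.
have s2 : `|rho (coords u1 y1 x2 y2) - rho (coords u1 v1 x2 y2)| <= K * D.
  rewrite (coords_move_y1 u1 y1) (coords_move_y1 u1 v1); apply: step; first exact: D1.2.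
  move=> t tt; rewrite -coords_move_y1.
  have [|_ _ ? _ _ //] := @frP (coords u1 t x2 y2).
  by split => //=; exact: mid0 tt.
have s3 : `|rho (coords u1 v1 x2 y2) - rho (coords u1 v1 u2 y2)| <= K * D.
  rewrite (coords_move_x2 u1 v1 x2) (coords_move_x2 u1 v1 u2); apply: step; first exact: D2.1.
  move=> t tt; rewrite -coords_move_x2.
  have [|_ _ _ ? _ //] := @frP (coords u1 v1 t y2).
  by split => //=; exact: mid0 tt.
have s4 : `|rho (coords u1 v1 u2 y2) - rho (coords u1 v1 u2 v2)| <= K * D.
  rewrite (coords_move_y2 u1 v1 u2 y2) (coords_move_y2 u1 v1 u2 v2); apply: step; first exact: D2.2.
  move=> t tt; rewrite -coords_move_y2.
  have [|_ _ _ _ ? //] := @frP (coords u1 v1 u2 t).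
  by split => //=; exact: mid0 tt.
have -> : 4 * K * D = K * D + K * D + (K * D + K * D) by ring.
move: s1 s2 s3 s4; rewrite !ler_norml.
move: (rho _) (rho _) (rho _) (rho _) (rho _) (K * D) => r1 r2 r3 r4 r5 k.
move=> /andP[? ?] /andP[? ?] /andP[? ?] /andP[? ?]; apply/andP; split; lra.
Qed.

(* If no nearest point exists, [bproj] is the junk value [0], far away from [z]. *)
Lemma bdelta_lower_bound z s : box (d / 2) z -> c * s <= - rho z ->
  c * s / (4 * K) <= d / 2 -> c * s / (4 * K) <= bdelta rho z.
Proof.
move=> bz rz sd.
have K40 : 0 < 4 * K by rewrite mulr_gt0.
have [z1 z2 z3 z4] := bz.
have bdz : box d z by apply: box_sub bz; rewrite ler_pdivrMr // ler_pMr // ler1n.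
rewrite /bdelta /bproj; case: xgetP => [q _ [bq _]|_]; last first.
  apply: le_trans sd _; apply: le_trans (cmod1_le_dist _ _).
  apply: le_trans (Re_le_cmod _); rewrite ReB /= subr0.
  by move: z1; rewrite ltr_norml ler_normr => /andP[? ?]; apply/orP; left; move: d2; lra.
have q0 := bdry_zero cr bq.
(* A nearest point inside the box is controlled by the Lipschitz bound; one outside is at distance
   at least [d / 2], since [z] lies in the half-size box. *)
have [bdq|nbq] := pselect (box d q).
  have := rho_lipschitz bdz bdq; rewrite q0 subr0 ler_norml => /andP[h1 _].
  by rewrite ler_pdivrMr // mulrC; move: h1 rz; lra.
apply: le_trans sd _; rewrite leNgt; apply/negP => dq; apply: nbq.
have h1 := lt_le_trans (le_lt_trans (cmod1_le_dist z q) dq) (lexx _).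
have h2 := lt_le_trans (le_lt_trans (cmod2_le_dist z q) dq) (lexx _).
have := le_lt_trans (Re_le_cmod _) h1; have := le_lt_trans (Im_le_cmod _) h1.
have := le_lt_trans (Re_le_cmod _) h2; have := le_lt_trans (Im_le_cmod _) h2.
rewrite !ReB !ImB; move: z1 z2 z3 z4; rewrite /box /=; clear h1 h2 dq rz bz bdz.
move: (complex.Re z.1) (complex.Im z.1) (complex.Re z.2) (complex.Im z.2).
move: (complex.Re q.1) (complex.Im q.1) (complex.Re q.2) (complex.Im q.2).
move=> u1 v1 u2 v2 x1 y1 x2 y2.
rewrite !ltr_norml => /andP[? ?] /andP[? ?] /andP[? ?] /andP[? ?].
move=> /andP[? ?] /andP[? ?] /andP[? ?] /andP[? ?].
by split; apply/andP; split; lra.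
Qed.

(* The points at distance [s] from [bpt x y w] in the direction of decreasing [x] are at
   distance at least [c s / (4 K)] from the boundary, so they approach nontangentially. *)
Lemma nt_limit_normal (f : C2 R -> Cc R) x y w (v : Cc R) e :
  bdry rho (bpt x y w) -> box (d / 4) (bpt x y w) -> nt_limit rho f (bpt x y w) v ->
  0 < e -> exists2 s0 : R, 0 < s0 & forall s, 0 < s < s0 ->
    cmod (f (bpt (x - s) y w) - v) < e.
Proof.
move=> bp bx nt e0; have p0 := bdry_zero cr bp.
have K40 : 0 < 4 * K by rewrite mulr_gt0.
(* The aperture: times the lower bound [c s / (4 K)] for [bdelta] it gives [s + c s / (4 K)], more
   than the distance [s] to the boundary point. *)
have b1 : 1 < 4 * K / c + 1 by rewrite ltrDr divr_gt0.
have /cvg_cmodP/(_ _ e0) := nt _ b1.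
move=> /near_C2P[d' d'0 H].
exists (Num.min d' (Num.min (d / 4) (d / 2 * (4 * K) / c))).
  by rewrite !lt_min d'0 !divr_gt0 // mulr_gt0 // divr_gt0.
move=> s /andP[s0]; rewrite !lt_min => /andP[sd' /andP[sd sK]].
have [b2 b3 b4 b5] := (box_bpt _ _ _ _).1 bx.
have bs : box (d / 2) (bpt (x - s) y w).
  apply/box_bpt; move: b2 b3 b4 b5 d0 s0 sd; rewrite !ltr_norml => /andP[? ?] *.
  by split => //; try lra; apply/andP; split; lra.
have sl : c * s <= - rho (bpt (x - s) y w).
  have := @rho_slope (x - s) x y w; rewrite opprB addrCA subrr addr0 p0 sub0r; apply.
  - by rewrite gerBl ltW.
  - by apply: box_sub bs; move: d0; lra.
  - by apply: box_sub bx; move: d0; lra.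
have zp : bpt (x - s) y w - bpt x y w = (((- (sg * s))%:C : Cc R), (0 : Cc R)).
  by congr pair; rewrite /= ?subrr //; simpc; congr (_ +i* _); ring.
have zp1 : cmod ((bpt (x - s) y w - bpt x y w).1) = s.
  by rewrite zp; apply: etrans (cmod_real _) _; rewrite normrN sign_norm gtr0_norm.
have distE : eucl_dist (bpt (x - s) y w) (bpt x y w) = s.
  rewrite /eucl_dist /eucl_norm zp1 [_.2](_ : _ = 0); last by rewrite /= subrr.
  by rewrite cmod0 expr0n /= addr0 sqrtr_sqr gtr0_norm.
apply: H => /=.
- by move: zp1 => /= ->.
- by rewrite subrr cmod0.
split.
  by rewrite /Dom /= -oppr_gt0; apply: lt_le_trans sl; rewrite mulr_gt0.
rewrite distE.
have low := @bdelta_lower_bound _ s bs sl.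
have {}low : c * s / (4 * K) <= bdelta rho (bpt (x - s) y w).
  by apply: low; rewrite ler_pdivrMr // mulrC -ler_pdivlMr // ltW.
apply: lt_le_trans (ler_wpM2l _ low); last by rewrite ltW // (lt_trans ltr01).
have -> : (4 * K / c + 1) * (c * s / (4 * K)) = s + c * s / (4 * K).
  by field; rewrite !gt_eqF.
by rewrite ltrDl divr_gt0 // mulr_gt0.
Qed.

Lemma cvg_bpt {T : Type} (F : set_system T) {FF : Filter F} (u v : T -> R)
    (om : T -> Cc R) x y w :
  u @ F --> x -> v @ F --> y -> om @ F --> w ->
  (fun t => bpt (u t) (v t) (om t)) @ F --> bpt x y w.
Proof.
move=> ux vy ow.
have c1 : (fun t => (1 + sg * u t) +i* (sg * v t) : Cc R) @ F -->
    ((1 + sg * x) +i* (sg * y) : Cc R); last exact: (cvg_pair c1 ow).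
apply: cvg_Complex.
  by apply: cvgD; [exact: cvg_cst|apply: cvgM => //; exact: cvg_cst].
by apply: cvgM => //; exact: cvg_cst.
Qed.

Lemma rho_bpt_cts x y w :
  (fun q : R * Cc R => rho (bpt x q.1 q.2)) @ ((y, w) : R * Cc R) --> rho (bpt x y w).
Proof.
have cb : (fun q : R * Cc R => bpt x q.1 q.2) @ ((y, w) : R * Cc R) --> bpt x y w.
  by apply: cvg_bpt; [exact: cvg_cst|exact: cvg_fst|exact: cvg_snd].
by move=> V /cr/cb.
Qed.

Lemma near_param (S : set (R * Cc R)) : (\forall q \near ((0, 0) : R * Cc R), S q) ->
  exists2 a : R, 0 < a & forall y w, `|y| < a -> `|complex.Re w| < a ->
    `|complex.Im w| < a -> S (y, w).
Proof.
case=> -[V W] [/= /nbhs_ballP[d1 d10 V1] /near_cmodP[e1 e10 W1]] H.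
exists (Num.min d1 (e1 / 2)); first by rewrite lt_min d10 divr_gt0.
move=> y w; rewrite !lt_min => /andP[y1 _] /andP[_ w1] /andP[_ w2].
apply: H; split => /=.
  by apply: V1; rewrite /ball /= sub0r normrN.
apply: W1; rewrite subr0; apply: le_lt_trans (cmod_le_ReIm _) _.
by move: w1 w2; lra.
Qed.

Definition params (a : R) : set (R * Cc R) :=
  [set q | [/\ `|q.1| < a, `|complex.Re q.2| < a & `|complex.Im q.2| < a]].

Lemma params_open a (q : R * Cc R) : params a q -> \forall q' \near q, params a q'.
Proof.
move=> [q1 q2 q3].
have n1 : (fun q' : R * Cc R => `|q'.1|) @ q --> `|q.1| by apply: cvg_norm; exact: cvg_fst.
have n2 : (fun q' : R * Cc R => `|complex.Re q'.2|) @ q --> `|complex.Re q.2|.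
  have m2 : (fun q' : R * Cc R => complex.Re q'.2) @ q --> complex.Re q.2.
    have s2 : (@snd R (Cc R)) @ q --> q.2 by exact: cvg_snd.
    by move=> V /(@cts_Re R)/s2.
  exact: cvg_norm m2.
have n3 : (fun q' : R * Cc R => `|complex.Im q'.2|) @ q --> `|complex.Im q.2|.
  have m3 : (fun q' : R * Cc R => complex.Im q'.2) @ q --> complex.Im q.2.
    have s2 : (@snd R (Cc R)) @ q --> q.2 by exact: cvg_snd.
    by move=> V /(@cts_Im R)/s2.
  exact: cvg_norm m3.
have e1 : \forall q' \near q, `|q'.1| < a by exact: n1 _ (lt_nbhsl q1).
have e2 : \forall q' \near q, `|complex.Re q'.2| < a by exact: n2 _ (lt_nbhsl q2).
have e3 : \forall q' \near q, `|complex.Im q'.2| < a by exact: n3 _ (lt_nbhsl q3).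
apply: filterS (filterI e1 (filterI e2 e3)).
by move=> q' [? [? ?]].
Qed.

(** Only a zero of [rho] is demanded; its uniqueness, the side on which the domain lies and the
    continuity of [H] follow from the monotonicity of [rho] in [x]. *)
Definition is_graph (a : R) (H : R * Cc R -> R) : Prop :=
  forall q : R * Cc R, params a q -> `|H q| < d / 2 /\ rho (bpt (H q) q.1 q.2) = 0.

(** [rho] has opposite signs at [x = - d / 2] and [x = d / 2] over the central parameter, hence over
    nearby ones; the intermediate value theorem applies. *)
Lemma exists_graph : rho (1, 0) = 0 -> exists2 a : R, 0 < a <= d / 4 &
  exists H, is_graph a H.
Proof.
move=> rP; have d20 : 0 < d / 2 by rewrite divr_gt0.
have dd : d / 2 < d by rewrite ltr_pdivrMr // ltr_pMr // ltr1n.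
have E0 : bpt 0 0 0 = (1, 0) by rewrite /bpt mulr0 addr0.
have b0 x : `|x| < d -> box d (bpt x 0 0).
  by move=> xd; apply/box_bpt; rewrite /= normr0; split.
have r0 : rho (bpt 0 0 0) = 0 by rewrite E0.
have neg : rho (bpt (- (d / 2)) 0 0) < 0.
  rewrite -[ltRHS]r0; apply: rho_strict; first by rewrite oppr_lt0.
    by apply: b0; rewrite normrN gtr0_norm.
  by apply: b0; rewrite normr0.
have pos : 0 < rho (bpt (d / 2) 0 0).
  rewrite -[ltLHS]r0; apply: rho_strict => //.
    by apply: b0; rewrite normr0.
  by apply: b0; rewrite gtr0_norm.
have n1 : \forall q \near ((0, 0) : R * Cc R), rho (bpt (- (d / 2)) q.1 q.2) < 0.
  exact: (rho_bpt_cts (lt_nbhsl neg)).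
have n2 : \forall q \near ((0, 0) : R * Cc R), 0 < rho (bpt (d / 2) q.1 q.2).
  exact: (rho_bpt_cts (lt_nbhsr pos)).
have [a a0 aP] := near_param (filterI n1 n2).
exists (Num.min a (d / 4)); first by rewrite lt_min a0 divr_gt0 //= ge_min lexx orbT.
suff ex (q : R * Cc R) : exists x, params (Num.min a (d / 4)) q ->
    `|x| < d / 2 /\ rho (bpt x q.1 q.2) = 0.
  exists (fun q : R * Cc R => xget 0 [set x | params (Num.min a (d / 4)) q ->
    `|x| < d / 2 /\ rho (bpt x q.1 q.2) = 0]) => q.
  by case: (ex q) => x xP; case: xgetP => [u _ //|/(_ x)].
case: q => y w; have [pq|npq] := pselect (params (Num.min a (d / 4)) (y, w)); last by exists 0.
have [/= y1 w1 w2] := pq; move: y1 w1 w2; rewrite !lt_min => /andP[y1 _] /andP[w1 _] /andP[w2 _].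
have [/= g1 g2] := aP y w y1 w1 w2.
have [x xI x0] : exists2 x, x \in `[- (d / 2), d / 2] & rho (bpt x y w) = 0.
  apply: (@IVT R (fun x => rho (bpt x y w)) (- (d / 2)) (d / 2) 0).
  - by rewrite ge0_cp // ltW.
  - apply: continuous_subspaceT => x.
    have cb : (fun x' : R => bpt x' y w) @ x --> bpt x y w.
      by apply: cvg_bpt; [exact: cvg_id|exact: cvg_cst|exact: cvg_cst].
    by move=> V /cr/cb.
  - by rewrite ge_min le_max (ltW g1) (ltW g2) orbT.
exists x => _; split => //; rewrite ltr_norml; move: xI; rewrite in_itv /= => /andP[x1 x2].
apply/andP; split; rewrite lt_neqAle ?x1 ?x2 andbT.
  by apply: contraTneq g1 => ->; rewrite x0 ltxx.
by apply: contraTneq g2 => <-; rewrite x0 ltxx.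
Qed.

(** * The graph function, boundary curves and slices *)

Section Graph.
Context (a : R) (H : R * Cc R -> R).
Context (a0 : 0 < a) (ad : a <= d / 4) (HP : is_graph a H).

Lemma params_box x y w e : `|x| < e -> a <= e -> params a (y, w) -> box e (bpt x y w).
Proof.
by move=> xe ae [/= *]; apply/box_bpt; split => //; apply: lt_le_trans ae.
Qed.

Let add : a <= d.
Proof. by apply: le_trans ad _; rewrite ler_pdivrMr // ler_pMr // ler1n. Qed.

Let Hd (q : R * Cc R) : params a q -> `|H q| < d.
Proof.
move=> /HP[h _]; apply: lt_trans h _.
by rewrite ltr_pdivrMr // ltr_pMr // ltr1n.
Qed.

Lemma graph_sign x y w : `|x| < d -> params a (y, w) ->
  (rho (bpt x y w) < 0) = (x < H (y, w)) /\ (rho (bpt x y w) = 0 -> x = H (y, w)).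
Proof.
move=> xd pa; have [_ h0] := HP pa.
have b1 := params_box xd add pa; have b2 := params_box (Hd pa) add pa.
have [l|l|->] := ltgtP x (H (y, w)).
- by have := rho_strict l b1 b2; rewrite h0 => r; split => // E; rewrite E ltxx in r.
- have := rho_strict l b2 b1; rewrite h0 => r; split.
    by apply/negbTE; rewrite -leNgt ltW.
  by move=> E; rewrite E ltxx in r.
- by rewrite h0 ltxx; split.
Qed.

Lemma graph_bdry (q : R * Cc R) : params a q -> bdry rho (bpt (H q) q.1 q.2).
Proof.
case: q => y w pa; have [_ h0] := HP pa.
apply: (bdry_of_limit (q := fun s => bpt (H (y, w) - s) y w) h0) => /= V nV.
have cb : (fun s : R => bpt (H (y, w) - s) y w) @ (0 : R) --> bpt (H (y, w)) y w.
  apply: cvg_bpt; [|exact: cvg_cst|exact: cvg_cst].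
  by rewrite -[X in _ --> X]subr0; apply: cvgB; [exact: cvg_cst|exact: cvg_id].
have cn : (fun s : R => `|H (y, w) - s|) @ (0 : R) --> `|H (y, w)|.
  by apply: cvg_norm; rewrite -[X in _ --> X]subr0; apply: cvgB; [exact: cvg_cst|exact: cvg_id].
have e1 : \forall s \near (0 : R), V (bpt (H (y, w) - s) y w) by exact: cb _ nV.
have e2 : \forall s \near (0 : R), `|H (y, w) - s| < d by exact: cn _ (lt_nbhsl (Hd pa)).
have /nbhs_ballP[e e0 eP] : nbhs (0 : R) (fun s =>
  V (bpt (H (y, w) - s) y w) /\ `|H (y, w) - s| < d) by exact: filterI e1 e2.
have [|Vs sd] := eP (e / 2).
  by rewrite /ball /= sub0r normrN gtr0_norm ?divr_gt0 // ltr_pdivrMr // ltr_pMr // ltr1n.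
exists (e / 2); split => //.
by rewrite (graph_sign sd pa).1 gtrBl divr_gt0.
Qed.

(** The signs of [rho] at heights [h - t] and [h + t] persist for nearby parameters and trap [H]
    between them. *)
Lemma graph_cts (q : R * Cc R) : params a q -> H x @[x --> q] --> H q.
Proof.
case: q => y w pa.
apply/(@cvgrPdist_lt _ _ _ (nbhs ((y, w) : R * Cc R)) (nbhs_filter _)) => e e0.
pose h := H (y, w); have hd := Hd pa; rewrite -/h in hd *.
pose t := Num.min e (d - `|h|) / 2.
have m0 : 0 < Num.min e (d - `|h|) by rewrite lt_min e0 subr_gt0.
have t0 : 0 < t by rewrite divr_gt0.
have te : t < e.
  by rewrite /t; have : Num.min e (d - `|h|) <= e; [rewrite ge_min lexx|lra].
have td : `|h| + t < d.
  by rewrite /t; have : Num.min e (d - `|h|) <= d - `|h|; [rewrite ge_min lexx orbT|lra].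
have d1 : `|h - t| < d by apply: le_lt_trans (ler_normB _ _) _; rewrite (gtr0_norm t0).
have d2' : `|h + t| < d by apply: le_lt_trans (ler_normD _ _) _; rewrite (gtr0_norm t0).
have neg : rho (bpt (h - t) y w) < 0 by rewrite (graph_sign d1 pa).1 gtrBl.
have pos : 0 < rho (bpt (h + t) y w).
  rewrite lt_neqAle eq_sym leNgt (graph_sign d2' pa).1 -/h -leNgt lerDl (ltW t0) andbT.
  apply/eqP => /((graph_sign d2' pa).2); rewrite -/h => E.
  by move: t0; rewrite -(ltrDl h) E ltxx.
have nneg : \forall q' \near ((y, w) : R * Cc R), rho (bpt (h - t) q'.1 q'.2) < 0.
  exact: (rho_bpt_cts (lt_nbhsl neg)).
have npos : \forall q' \near ((y, w) : R * Cc R), 0 < rho (bpt (h + t) q'.1 q'.2).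
  exact: (rho_bpt_cts (lt_nbhsr pos)).
apply: filterS (filterI (params_open pa) (filterI nneg npos)).
move=> -[y' w'] [pa' [/= g1 g2]].
rewrite (graph_sign d1 pa').1 in g1.
have g3 : H (y', w') <= h + t.
  by rewrite leNgt -(graph_sign d2' pa').1 -leNgt ltW.
by rewrite distrC ltr_norml; apply/andP; split; lra.
Qed.

Lemma graph0 : rho (1, 0) = 0 -> H (0, 0) = 0.
Proof.
move=> rP; apply/esym; apply: (graph_sign _ _).2.
- by rewrite normr0.
- by rewrite /params /= normr0; split.
- by rewrite /bpt mulr0 addr0.
Qed.

(* A sequence of bad boundary points tending to [(1, 0)] would lie on a single
   boundary curve ending there. *)
Lemma boundary_values_near (f : C2 R -> Cc R) (l : Cc R) (e : R) : rho (1, 0) = 0 ->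
  (forall phi : R -> C2 R, boundary_curve rho phi -> phi 1 = (1, 0) ->
     (\forall t \near 1^'-, exists v, nt_limit rho f (phi t) v) /\
     bvalue rho f (phi t) @[t --> 1^'-] --> l) -> 0 < e ->
  exists2 r : R, 0 < r <= a & forall q : R * Cc R, params r q ->
    exists v, nt_limit rho f (bpt (H q) q.1 q.2) v /\ cmod (v - l) < e.
Proof.
move=> rP curves e0; apply: contrapT => nex.
pose good (q : R * Cc R) :=
  exists v, nt_limit rho f (bpt (H q) q.1 q.2) v /\ cmod (v - l) < e.
(* The decay [1 / (n + 1)] is what [exists_interpolation] requires; [a / 2] keeps the interpolating
   path where [H] is defined by the graph. *)
pose rad (n : nat) : R := Num.min (a / 2) n.+1%:R^-1.
have rad0 n : 0 < rad n by rewrite lt_min divr_gt0 // invr_gt0 ltr0n.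
have rada n : rad n <= a / 2 by rewrite ge_min lexx.
have radn n : rad n <= n.+1%:R^-1 by rewrite ge_min lexx orbT.
have a2 : a / 2 < a by rewrite ltr_pdivrMr // ltr_pMr // ltr1n.
have bad n : exists q : R * Cc R, params (rad n) q /\ ~ good q.
  apply: contrapT => nb; apply: nex; exists (rad n).
    by rewrite rad0 (le_trans (rada n)) // ltW.
  by move=> q pq; apply: contrapT => ng; apply: nb; exists q.
have [Q QP] := choice bad.
have [q1 q2 q3] : [/\ forall n, `|(Q n).1| <= rad n,
    forall n, `|complex.Re (Q n).2| <= rad n & forall n, `|complex.Im (Q n).2| <= rad n].
  by split=> n; have [[/ltW ? /ltW ? /ltW ?] _] := QP n.
have [g1 [g1c g11 g1B g1n]] := exists_interpolation (fun n => le_trans (q1 n) (radn n)).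
have [g2 [g2c g21 g2B g2n]] := exists_interpolation (fun n => le_trans (q2 n) (radn n)).
have [g3 [g3c g31 g3B g3n]] := exists_interpolation (fun n => le_trans (q3 n) (radn n)).
pose gam t : R * Cc R := (g1 t, g2 t +i* g3 t).
have gamP t : params a (gam t).
  split => /=; apply: le_lt_trans a2.
  - by apply: g1B => n; apply: le_trans (q1 n) (rada n).
  - by apply: g2B => n; apply: le_trans (q2 n) (rada n).
  - by apply: g3B => n; apply: le_trans (q3 n) (rada n).
pose phi t := bpt (H (gam t)) (gam t).1 (gam t).2.
have cgam t : gam x @[x --> t] --> gam t.
  have c3 : (fun x => g2 x +i* g3 x : Cc R) @ t --> (g2 t +i* g3 t : Cc R).
    exact: (cvg_Complex (g2c t) (g3c t)).
  exact: (cvg_pair (g1c t) c3).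
have cphi : continuous phi.
  move=> t; apply: cvg_bpt.
  - by move=> V /(graph_cts (gamP t))/cgam.
  - exact: g1c.
  - exact: (cvg_Complex (g2c t) (g3c t)).
have [] := curves phi.
- split; first exact: continuous_subspaceT.
  by move=> t _; exact: graph_bdry.
- by rewrite /phi /gam g11 g21 g31 [H _](graph0 rP) /bpt mulr0 addr0.
move=> near_ex /cvg_cmodP/(_ _ e0) near_l.
have /nbhs_ballP[u u0 uP] : nbhs (1 : R) (fun t => t < 1 -> good (gam t)).
  have n1 : nbhs (1 : R) (fun t => t < 1 -> exists v, nt_limit rho f (phi t) v) := near_ex.
  have n2 : nbhs (1 : R) (fun t => t < 1 -> cmod (bvalue rho f (phi t) - l) < e) := near_l.
  (* [bvalue] has a default value, so its closeness to [l] is meaningful only together with the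
     existence of the limit. *)
  apply: filterS (filterI n1 n2) => t [h1 h2] t1; exists (bvalue rho f (phi t)).
  by split; [exact: xgetPex (h1 t1)|exact: h2].
have [n nu] : exists n : nat, n.+1%:R^-1 < u.
  have [n _ nP] := near_infty_natSinv_lt (PosNum u0).
  by exists n; have := nP n (leqnn n).
(* The shifted index makes [1 - t = 1 / (n + 3/2)] smaller than [1 / (n + 1) < u]. *)
pose t := @interpolation_time R n.+1.
have k0 : 0 < n.+1%:R + 2^-1 :> R by rewrite ltr_wpDl // invr_gt0.
have t1 : t < 1 by rewrite /t /interpolation_time ltrBlDr ltrDl invr_gt0.
have gE : gam t = Q n.+1.
  by rewrite /gam g1n g2n g3n; case: (Q n.+1) => y [w1 w2].
have [_ ng] := QP n.+1; apply: ng; rewrite -gE; apply: uP => //.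
rewrite /ball /= /t /interpolation_time opprB addrC subrK gtr0_norm ?invr_gt0 //.
apply: le_lt_trans nu; rewrite lef_pV2 ?posrE ?ltr0n //.
by rewrite lerDl invr_ge0.
Qed.

(** The coordinate on the slice is [sg (z1 - 1)], which is complex affine, so its difference
    quotients are those of [f] in the direction [(sg, 0)]. *)
Lemma derivable_slice (f : C2 R -> Cc R) (l w z : Cc R) :
  differentiable f (bpt (complex.Re z) (complex.Im z) w) ->
  derivable (fun u : Cc R => f (bpt (complex.Re u) (complex.Im u) w) - l : Cc R) z 1.
Proof.
move=> df; pose v : C2 R := (sg%:C, 0).
have dv : derivable f (bpt (complex.Re z) (complex.Im z) w) v by exact: diff_derivable.
pose F (u : Cc R) : Cc R := f (bpt (complex.Re u) (complex.Im u) w) - l.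
rewrite -/F /derivable (_ : (fun h : R[i] => h^-1 *: ((F \o shift z) (h *: (1 : Cc R)) - F z)) =
  (fun h => h^-1 *: ((f \o shift (bpt (complex.Re z) (complex.Im z) w)) (h *: v) -
    f (bpt (complex.Re z) (complex.Im z) w)))); first exact: dv.
apply/funext => h; rewrite /F /=.
rewrite opprB addrA subrK; congr (_ *: (f _ - _)).
rewrite /bpt; congr pair => /=; last by rewrite scaler0 add0r.
rewrite -![_ *: _]/(_ * _) mulr1; case: h z {df dv F} => h1 h2 [z1 z2] /=.
by simpc; congr (_ +i* _); ring.
Qed.

(** Boundary values within [e / 6] of [l], approached along the normal up to [e / 6], give the
    vertical bound [e / 3]; [graph_uniform] doubles it to [2 e / 3 < e]. *)
Lemma unrestricted_limit (f : C2 R -> Cc R) (l : Cc R) (e : R) : rho (1, 0) = 0 ->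
  (forall z, Dom rho z -> differentiable f z) ->
  (forall z, Dom rho z -> cmod (f z) <= 1) ->
  (forall phi : R -> C2 R, boundary_curve rho phi -> phi 1 = (1, 0) ->
     (\forall t \near 1^'-, exists v, nt_limit rho f (phi t) v) /\
     bvalue rho f (phi t) @[t --> 1^'-] --> l) -> 0 < e ->
  \forall z \near ((1, 0) : C2 R), Dom rho z -> cmod (f z - l) < e.
Proof.
move=> rP df fb curves e0.
have e60 : 0 < e / 6 by rewrite divr_gt0.
have e30 : 0 < e / 3 by rewrite divr_gt0.
have [r /andP[r0 ra] rv] := boundary_values_near rP curves e60.
pose b := d / 2; have b0 : 0 < b by rewrite divr_gt0.
have p0 : params a (0, 0) by rewrite /params /= normr0; split.
have small t : 0 < t -> exists2 u : R, 0 < u & forall y w, params u (y, w) -> `|H (y, w)| < t.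
  move=> t0; have n1 : \forall q \near ((0, 0) : R * Cc R), `|H q| < t.
    have cn : `|H q| @[q --> ((0, 0) : R * Cc R)] --> `|H (0, 0)|.
      by apply: cvg_norm; exact: graph_cts p0.
    by apply: cn (lt_nbhsl _); rewrite graph0 // normr0.
  have [u u0 uP] := near_param n1; exists u => // y w [/= h1 h2 h3].
  exact: uP.
have b40 : 0 < b / 4 by rewrite divr_gt0.
have [u u0 uP] := small _ b40.
pose a' := Num.min r u / 2.
have m0 : 0 < Num.min r u by rewrite lt_min r0.
have a'0 : 0 < a' by rewrite divr_gt0.
have a'm : a' < Num.min r u by rewrite /a'; lra.
have a'r : a' < r by apply: lt_le_trans a'm _; rewrite ge_min lexx.
have a'u : a' < u by apply: lt_le_trans a'm _; rewrite ge_min lexx orbT.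
have [dl dl0 dlP] := graph_uniform (1 + cmod l) a'0 b0 e30.
have dl20 : 0 < dl / 2 by rewrite divr_gt0.
have [u2 u20 u2P] := small _ dl20.
(* In this box [|y| <= a' / 2], and both [|x|] and [|h y|] are below [dl / 2], so the depth
   [h y - x] is below [dl]. *)
pose a3 := Num.min (Num.min (a' / 2) u2) (Num.min (dl / 2) d).
have a30 : 0 < a3 by rewrite !lt_min u20 dl20 d0 divr_gt0.
have a3a : a3 <= a' / 2 by rewrite !ge_min lexx.
have a3u : a3 <= u2 by rewrite !ge_min lexx orbT.
have a3dl : a3 <= dl / 2 by rewrite !ge_min lexx !orbT.
have a3d : a3 <= d by rewrite !ge_min lexx !orbT.
apply: filterS (box_near a30) => z bz; rewrite (bptE z) in bz *.
set x := sg * _ in bz *; set y := sg * _ in bz *; set w := z.2 in bz *.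
move/box_bpt : bz => [zx zy zw1 zw2] Dz.
have a3a' : a3 < a'.
  by apply: le_lt_trans a3a _; rewrite ltr_pdivrMr // ltr_pMr // ltr1n.
have w1 : `|complex.Re w| < a' by apply: lt_trans a3a'.
have w2 : `|complex.Im w| < a' by apply: lt_trans a3a'.
pose clamp t := Num.max (- a') (Num.min a' t).
have clampE t : - a' <= t <= a' -> clamp t = t.
  by move=> /andP[t1 t2]; rewrite /clamp (min_idPr t2) (max_idPr t1).
have clampP t : `|clamp t| <= a'.
  rewrite ler_norml /clamp le_max lexx /= ge_max ge_min lexx /= andbT.
  by rewrite lerNl (le_trans _ (ltW a'0)) // oppr_le0 ltW.
have cc : continuous clamp.
  move=> t; apply: (@continuous_max _ _ (cst (- a')) (fun t => Num.min a' t)).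
    exact: cst_continuous.
  apply: (@continuous_min _ _ (cst a') id); first exact: cst_continuous.
  exact: cvg_id.
pose h t := H (clamp t, w).
have pw e' t : a' < e' -> params e' (clamp t, w).
  move=> ae; split => /=; [exact: le_lt_trans (clampP t) ae|exact: lt_trans ae..].
have ch : continuous h.
  move=> t; have ca : (fun t => (clamp t, w) : R * Cc R) @ t --> ((clamp t, w) : R * Cc R).
    exact: (cvg_pair (cc t) (cvg_cst w)).
  by move=> V /(graph_cts (pw _ t (lt_le_trans a'r ra)))/ca.
have hb t : `|h t| < b / 4 by apply: uP; exact: pw.
have hs s t : - a' < t < a' -> h t - b < s < h t -> Dom rho (bpt s t w).
  move=> /andP[t1 t2] /andP[s1 s2].
  have tE : clamp t = t by apply: clampE; rewrite !ltW.
  have sd : `|s| < d.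
    by apply: (strip_norm (hb t)); rewrite s1 s2.
  have pt : params a (t, w) by rewrite -tE; apply: pw; exact: lt_le_trans ra.
  by rewrite /Dom /= (graph_sign sd pt).1 -tE.
pose g (v : Cc R) : Cc R := f (bpt (complex.Re v) (complex.Im v) w) - l.
have strip v : graph_strip h (- a') a' b v -> Dom rho (bpt (complex.Re v) (complex.Im v) w).
  by move=> [v1 v2]; exact: hs.
have py : params u2 (y, w) by split => /=; apply: lt_le_trans a3u.
have ya : - a' < y < a' by rewrite -ltr_norml; apply: lt_trans a3a'.
have yE : clamp y = y by case/andP: ya => /ltW y1 /ltW y2; apply: clampE; rewrite y1 y2.
have xH : x < h y.
  have xd : `|x| < d by apply: lt_le_trans a3d.
  have pa : params a (y, w) by rewrite -yE; apply: pw; exact: lt_le_trans ra.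
  by move: Dz; rewrite /Dom /= (graph_sign xd pa).1 /h yE.
have := dlP h g ch _ _ _ _ y (h y - x).
have -> : h y - (h y - x) = x by ring.
move=> H1; apply: le_lt_trans (H1 _ _ _ _ _ _) _ => {H1}.
- by move=> t _; rewrite ltW.
- by move=> v /strip/df; exact: derivable_slice.
- move=> v /strip/fb fv; apply: le_trans (cmodB _ _) _; exact: lerD.
- move=> t /andP[t1 t2].
  have tE : clamp t = t by apply: clampE; rewrite !ltW.
  have pr : params r (t, w) by rewrite -tE; exact: pw.
  have pa : params a (t, w) by rewrite -tE; apply: pw; exact: lt_le_trans ra.
  have [v [ntv vl]] := rv _ pr.
  have ht : H (t, w) = h t by rewrite /h tE.
  rewrite /= ht in ntv.
  have bt : bdry rho (bpt (h t) t w) by rewrite -ht; exact: graph_bdry pa.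
  have bx : box (d / 4) (bpt (h t) t w).
    apply: params_box ad pa; apply: lt_trans (hb t) _; rewrite /b.
    by rewrite ltr_pM2r // ltr_pdivrMr // ltr_pMr // ltr1n.
  have [s0 s00 sP] := nt_limit_normal bt bx ntv e60.
  exists s0 => // s ss; rewrite /g /=.
  have := sP s ss; have := cmodD (f (bpt (h t - s) t w) - v) (v - l).
  by rewrite addrA subrK; lra.
- by apply: ltW; apply: lt_le_trans a3a.
- rewrite subr_gt0 xH /=.
  have := u2P _ _ py; rewrite -yE -/(h y) yE ltr_norml => /andP[_ h1].
  by move: zx; rewrite ltr_norml => /andP[x1 _]; lra.
- by lra.
Qed.

End Graph.

End LocalGraph.

Theorem theorem3p2 (R : realType) (rho : C2 R -> R) (m : nat)
  (X : C2 R -> C2 R * C2 R) (U : set (C2 R)) (Q : C2 R * C2 R -> Cc R)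
  (A : set (C2 R)) (f : C2 R -> Cc R) (l : Cc R) :
  let P : C2 R := (1, 0) in
  smooth_defining rho ->
  connected (Dom rho) ->
  (2 <= m)%N ->
  finite_type_max rho m ->
  bdry rho P ->
  (exists2 c : R, c != 0 & grad rho P = (c%:C, 0)) ->
  wd (ex1 R) (rhoC rho) P != 0 ->
  wdbar (ex1 R) (rhoC rho) P != 0 ->
  U P -> transverse_on rho U X ->
  polarization rho Q ->
  A `<=` Dom rho ->
  comparable1 rho X m Q P A ->
  (forall z, A z -> eucl_dist z P ^+ m < cmod (z.1 - 1)) ->
  (forall z, Dom rho z -> differentiable f z) ->
  (forall z, Dom rho z -> cmod (f z) <= 1) ->
  (forall phi : R -> C2 R, boundary_curve rho phi -> phi 1 = P ->
     (\forall t \near 1^'-, exists v, nt_limit rho f (phi t) v) /\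
     bvalue rho f (phi t) @[t --> 1^'-] --> l) ->
  cmod (f z - l) @[z --> within A (nbhs P)] --> (0 : R).
Proof.
move=> P [sm _] _ _ _ bP gP _ _ _ _ _ AD _ _ df fb curves.
have rP : rho (1, 0) = 0 := bdry_zero (defining_cts sm) bP.
have [sg [d [c [K fr]]]] := exists_bounded_frame sm gP.
have [a /andP[a0 ad] [H HP]] := exists_graph fr rP.
apply/cvgrPdist_lt => e e0.
apply: filterS (unrestricted_limit fr a0 ad HP rP df fb curves e0) => z Hz /AD/Hz.
by rewrite sub0r normrN ger0_norm ?cmod_ge0.
Qed.
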